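(* For all $n\in\mathbb{N}$, $\mathrm{SL}_n(\mathrm{AP}^+)=\mathrm{E}_n(\mathrm{AP}^+)$.
   Context: $\mathbb{N}=\{1,2,3,\dots\}$. For $\lambda\in\mathbb{R}$ let $\mathbf{e}_\lambda:=e^{i\lambda\,\cdot}\in L^\infty(\mathbb{R})$. Let $\mathcal{T}$ be the linear span (over $\mathbb{C}$) of $\{\mathbf{e}_\lambda:\lambda\in\mathbb{R}\}$, and let $\mathrm{AP}$ be the closure of $\mathcal{T}$ in $L^\infty(\mathbb{R})$ with respect to $\|\cdot\|_\infty$; it is a Banach algebra with pointwise operations and the norm $\|\cdot\|_\infty$. On $\mathcal{T}$ consider the inner product $\langle p,q\rangle=\lim_{R\to+\infty}\frac{1}{2R}\int_{-R}^R p(x)\overline{q(x)}\,dx$. For $f\in\mathrm{AP}$ and $\lambda\in\mathbb{R}$, the Bohr-Fourier coefficient is $f_\lambda:=\lim_{n\to\infty}\langle p_n,\mathbf{e}_{\lambda}\rangle$, where $(p_n)_n$ is any sequence in $\mathcal{T}$ converging to $f$ in $\mathrm{AP}$. The Bohr spectrum of $f$ is $\sigma(f)=\{\lambda\in\mathbb{R}:f_\lambda\neq0\}$. Define $\mathrm{AP}^+=\{f\in\mathrm{AP}:\sigma(f)\subset[0,+\infty)\}$, a Banach algebra with pointwise operations and the norm $\|\cdot\|_\infty$. For a commutative unital ring $R$ and $n\in\mathbb{N}$, $\mathrm{SL}_n(R)$ is the group of $n\times n$ matrices over $R$ with determinant $1$. An elementary matrix is a matrix $I_n+\alpha\,\mathbf{e}_{ij}$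 with $i\neq j$, $\alpha\in R$, where $\mathbf{e}_{ij}$ has entry $1$ in position $(i,j)$ and zeros elsewhere. $\mathrm{E}_n(R)$ is the subgroup of $\mathrm{SL}_n(R)$ generated by the elementary matrices. *)

(* Defs.v *)
From HB Require Import structures.
From mathcomp Require Import all_boot all_order all_algebra.
From mathcomp Require Import ring_quotient generic_quotient.
From mathcomp Require Import all_classical all_reals all_analysis.
From mathcomp Require Import measurable_realfun ess_sup_inf.
From mathcomp Require Import complex.

Set Implicit Arguments.
Unset Strict Implicit.
Unset Printing Implicit Defensive.

Import Order.TTheory GRing.Theory Num.Theory.
Import numFieldNormedType.Exports.
Import ComplexField Normc.

Local Open Scope classical_set_scope.
Local Open Scope ring_scope.
Local Open Scope complex_scope.

Section LinftySpace.
Variable R : realType.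
Local Notation C := R[i].
Local Notation mu := (@lebesgue_measure R).
Implicit Types f g : R -> C.

Definition essnorm f : \bar R := ess_sup mu (fun x => (normc (f x))%:E).

Lemma essnorm_ltoo f : (essnorm f < +oo)%E <->
  exists M : R, {ae mu, forall x, normc (f x) <= M}.
Proof.
have aeF := ae_filter_ringOfSetsType mu.
split=> [/ereal_inf_lt[y]|[M fM]].
  case: y => [M fM _|_|fM _]; last 2 first.
  - by rewrite ltxx.
  - by exists 0; apply: filterS fM => x; rewrite leeNy_eq.
  by exists M; apply: filterS fM => x; rewrite lee_fin.
apply: (@le_lt_trans _ _ M%:E); last exact: ltry.
by apply: ereal_inf_lbound; apply: filterS fM => x; rewrite lee_fin.
Qed.

(** Measurability of a complex function is that of its two components. *)
Definition linf_fun : {pred (R -> C)} := fun f =>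
  `[< [/\ measurable_fun setT (fun x => complex.Re (f x)),
          measurable_fun setT (fun x => complex.Im (f x)) &
          (essnorm f < +oo)%E] >].

Lemma linf_funP f : reflect
  [/\ measurable_fun setT (fun x => complex.Re (f x)),
      measurable_fun setT (fun x => complex.Im (f x)) &
      exists M : R, {ae mu, forall x, normc (f x) <= M}]
  (f \in linf_fun).
Proof.
by apply: (iffP (asboolP _)) => -[? ? /essnorm_ltoo ?]; split.
Qed.

Lemma linf_fun_subring : subring_closed linf_fun.
Proof.
have aeF := ae_filter_ringOfSetsType mu.
split.
- apply/linf_funP; split; [exact: measurable_cst|exact: measurable_cst|].
  by exists 1; apply/aeW => x; rewrite normc1.
- move=> f g /linf_funP[mf1 mf2 [M fM]] /linf_funP[mg1 mg2 [N gN]].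
  apply/linf_funP; split.
  + rewrite (_ : (fun _ => _) =
      (fun x => complex.Re (f x)) \- (fun x => complex.Re (g x))).
      exact: measurable_funB.
    by apply/funext => x /=; rewrite -raddfB.
  + rewrite (_ : (fun _ => _) =
      (fun x => complex.Im (f x)) \- (fun x => complex.Im (g x))).
      exact: measurable_funB.
    by apply/funext => x /=; rewrite -raddfB.
  + exists (M + N); apply: filterS2 fM gN => x fM gN.
    by apply: (le_trans (le_normcD _ _)); rewrite normcN lerD.
- move=> f g /linf_funP[mf1 mf2 [M fM]] /linf_funP[mg1 mg2 [N gN]].
  apply/linf_funP; split.
  + rewrite (_ : (fun _ => _) =
      (fun x => complex.Re (f x)) \* (fun x => complex.Re (g x)) \-
      (fun x => complex.Im (f x)) \* (fun x => complex.Im (g x))).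
      by apply: measurable_funB; exact: measurable_funM.
    apply/funext => x; rewrite /GRing.mul /=.
    by case: (f x) (g x) => [a b] [c d].
  + rewrite (_ : (fun _ => _) =
      (fun x => complex.Re (f x)) \* (fun x => complex.Im (g x)) \+
      (fun x => complex.Im (f x)) \* (fun x => complex.Re (g x))).
      by apply: measurable_funD; exact: measurable_funM.
    apply/funext => x; rewrite /GRing.mul /=.
    by case: (f x) (g x) => [a b] [c d].
  + exists (M * N); apply: filterS2 fM gN => x fM gN.
    have normc_ge0 (z : C) : 0 <= normc z by case: z => a b; exact: sqrtr_ge0.
    by rewrite normcM; apply: ler_pM.
Qed.

HB.instance Definition _ :=
  GRing.isSubringClosed.Build (R -> C) linf_fun linf_fun_subring.

Record LinfFun := MkLinfFun { linf_val :> R -> C ; _ : linf_val \in linf_fun }.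
HB.instance Definition _ := [isSub for linf_val].
HB.instance Definition _ := [Choice of LinfFun by <:].
HB.instance Definition _ := [SubChoice_isSubComNzRing of LinfFun by <:].

Definition ae_null : {pred LinfFun} := fun u =>
  `[< {ae mu, forall x, u x = 0} >].

Lemma ae_null_idealr : idealr_closed ae_null.
Proof.
have aeF := ae_filter_ringOfSetsType mu.
split.
- by apply/asboolP/aeW.
- apply/negP => /asboolP -[N [mN N0 sN]].
  have NT : N = setT.
    by apply/seteqP; split=> // x _; apply: sN => /= /eqP; rewrite oner_eq0.
  by move: N0; rewrite NT -set_itvNyy lebesgue_measure_itv.
- move=> a u v /asboolP u0 /asboolP v0; apply/asboolP.
  apply: filterS2 u0 v0 => x u0 v0.
  suff -> : (a * u + v) x = a x * u x + v x by rewrite u0 v0 mulr0 addr0.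
  by [].
Qed.

HB.instance Definition _ := isIdealr.Build LinfFun ae_null ae_null_idealr.

Definition Linf : comNzRingType := {ideal_quot ae_null}.

Definition to_Linf (u : LinfFun) : Linf := \pi_({ideal_quot ae_null})%qT u.

Definition Linf_repr (F : Linf) : LinfFun := repr (F : {ideal_quot ae_null}).

(** [essnorm] depends only on the a.e. class, so any representative will do. *)
Definition Linf_norm (F : Linf) : \bar R := essnorm (Linf_repr F).

Lemma cst_linf_fun (c : C) : (fun _ : R => c) \in linf_fun.
Proof.
apply/linf_funP; split; [exact: measurable_cst|exact: measurable_cst|].
by exists (normc c); apply/aeW.
Qed.

Definition Linf_cst (c : C) : Linf := to_Linf (MkLinfFun (cst_linf_fun c)).

Lemma expi_linf_fun (l : R) :
  (fun x : R => cos (l * x) +i* sin (l * x)) \in linf_fun.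
Proof.
have ml : measurable_fun setT (fun x : R => l * x) by exact: mulrl_measurable.
apply/linf_funP; split => /=.
- apply: (measurableT_comp _ ml); apply: continuous_measurable_fun.
  exact: continuous_cos.
- apply: (measurableT_comp _ ml); apply: continuous_measurable_fun.
  exact: continuous_sin.
- by exists 1; apply/aeW => x; rewrite /normc cos2Dsin2 sqrtr1.
Qed.

(** [expi l] is the class of [x |-> e^(i l x)]. *)
Definition expi (l : R) : Linf := to_Linf (MkLinfFun (expi_linf_fun l)).

Definition trigpoly : set Linf :=
  [set P | exists s : seq (C * R),
     P = \sum_(t <- s) Linf_cst t.1 * expi t.2].

Definition AP : set Linf :=
  [set F | forall eps : R, 0 < eps ->
     exists2 P, trigpoly P & (Linf_norm (F - P) < eps%:E)%E].

Definition cintegral (D : set R) f : C :=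
  (\int[mu]_(x in D) complex.Re (f x)) +i* (\int[mu]_(x in D) complex.Im (f x)).

Definition inner (P Q : Linf) : C :=
  lim ((((2 * r)^-1)%:C *
     cintegral `[- r, r] (fun x => Linf_repr P x * (Linf_repr Q x)^*) : C^o)
    @[r --> +oo]).

(** The coefficient is the common limit along all approximating sequences
    from [trigpoly]; such a limit exists and is unique when [AP F]. *)
Definition bohr_coef (F : Linf) (l : R) : C :=
  xget 0 [set c | forall p : nat -> Linf,
    (forall n, trigpoly (p n)) ->
    Linf_norm (p n - F) @[n --> \oo] --> 0%E ->
    (inner (p n) (expi l) : C^o) @[n --> \oo] --> (c : C^o)].

Definition bohr_spectrum (F : Linf) : set R := [set l | bohr_coef F l != 0].

Definition APplus : set Linf :=
  [set F | AP F /\ bohr_spectrum F `<=` `[0, +oo[].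

End LinftySpace.

Section SpecialLinear.
Variables (A : comNzRingType) (S : set A) (n : nat).

(** [S] is meant to be (the carrier of) a unital subring of [A]; its matrices
    are the matrices over [A] with all entries in [S]. *)
Definition SLn : set 'M[A]_n := [set M : 'M[A]_n | (forall i j, S (M i j)) /\ \det M = 1].

Definition elementary : set 'M[A]_n :=
  [set M : 'M[A]_n | exists i j : 'I_n, exists2 a : A,
     i != j & S a /\ M = 1%:M + a *: delta_mx i j].

(** [M *m N = 1%:M] says that [N] is the inverse of [M]. *)
Definition SL_subgroup (H : set 'M[A]_n) : Prop :=
  [/\ H `<=` SLn, H 1%:M,
      forall M N, H M -> H N -> H (M *m N) &
      forall M N, H M -> M *m N = 1%:M -> H N].

Definition En : set 'M[A]_n := smallest SL_subgroup elementary.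

End SpecialLinear.

Arguments SLn {A} S n.
Arguments En {A} S n.

(* Main.v *)
Require Import Defs.
From HB Require Import structures.
From mathcomp Require Import all_boot all_order all_algebra.
From mathcomp Require Import all_classical all_reals all_analysis.
From mathcomp Require Import measurable_realfun ess_sup_inf.
From mathcomp Require Import ring_quotient generic_quotient complex.
From mathcomp Require Import ring lra.

(** For [f] in AP+, moving [x] to [x + i y] multiplies the Bohr coefficient of
    index [l] by [e^(- l y)]; the result tends to a constant as [y] grows. Done
    on all entries of a matrix, this joins it, through invertible matrices, to
    a constant one, which is a product of elementary and diagonal matrices. Two
    consecutive points of a fine subdivision of the path differ by a factor
    close to the identity, on which Gaussian elimination meets only invertible
    pivots; and a product of elementary and diagonal matrices that has
    determinant 1 is a product of elementary matrices (Whitehead).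

    The path is only needed for matrices of trigonometric sums [P], [Q] that
    approximate the given matrix and its inverse: [Q P] stays close to the
    identity all along, because a multiplicative multiplier [m] with [|m| <= 1]
    contracts the sup norm. Indeed each coefficient of [s ^ k] is at most
    [|s| ^ k], and there are at most [(k + 1) ^ n] of them, so that
    [|m s| ^ k = |m (s ^ k)| <= (k + 1) ^ n |s| ^ k] for all [k].

    That an element of AP+ is a limit of sums with nonnegative frequencies is
    proved with the Bochner-Fejer argument, the kernel being a normalized power
    of the mean of the [(1 + cos (l x)) / 2]; no rational basis of the
    frequencies is needed. *)

Set Implicit Arguments.
Unset Strict Implicit.
Unset Printing Implicit Defensive.

Import Order.TTheory GRing.Theory Num.Theory.
Import numFieldNormedType.Exports.
Import ComplexField Normc.
Local Open Scope classical_set_scope.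
Local Open Scope ring_scope.

(** * Elementary matrices over a subring *)

(** One step of Gaussian elimination with the invertible pivot [a]; the lower right block that
    remains is the Schur complement. *)
Lemma block_LDU (A : comNzRingType) n (a a' : A) (b : 'rV_n) (c : 'cV_n)
    (d : 'M[A]_n) : a * a' = 1 ->
  block_mx a%:M b c d =
  block_mx 1%:M 0 (a' *: c) 1%:M *m block_mx a%:M 0 0 (d - a' *: (c *m b)) *m
  block_mx 1%:M (a' *: b) 0 1%:M :> 'M[_]_(1 + n).
Proof.
move=> aa'; rewrite !mulmx_block !mulmx0 !mul0mx !mulmx1 !mul1mx !addr0 !add0r.
rewrite !mul_scalar_mx scalerA aa' scale1r mul_mx_scalar scalerA aa' scale1r.
by rewrite -scalemxAr addrC subrK.
Qed.

(** Up to transposition the matrix is lower triangular with ones on the diagonal. *)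
Lemma det_elementary (A : comNzRingType) n (i j : 'I_n) (a : A) :
  i != j -> \det (1%:M + a *: delta_mx i j) = 1.
Proof.
wlog ltji : i j / (j < i)%N => [hw ij|ij].
  have [/hw->//|] := ltnP j i.
  rewrite leq_eqVlt val_eqE (negbTE ij) /= => lij.
  by rewrite -det_tr linearD linearZ /= trmx1 trmx_delta hw// eq_sym.
rewrite det_trig; first by apply: big1 => k _; rewrite !mxE eqxx;
  case: eqP => [->|_]; rewrite ?(negbTE ij) ?andbF ?mulr0 ?addr0 //=.
apply/is_trig_mxP => k l kl; rewrite !mxE -val_eqE (ltn_eqF kl) add0r.
case: eqP => [ki|_]; last by rewrite mulr0.
case: eqP => [lj|_]; last by rewrite mulr0.
by move: kl; rewrite ki lj ltnNge ltnW.
Qed.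

Definition unital_subring (A : comNzRingType) (S : set A) :=
  [/\ S 1, forall x y, S x -> S y -> S (x - y) &
      forall x y, S x -> S y -> S (x * y)].

Section ElementaryMatrices.
Variables (A : comNzRingType) (S : set A).
Hypothesis hS : unital_subring S.

Lemma sring1 : S 1. Proof. by case: hS. Qed.

Lemma sringB x y : S x -> S y -> S (x - y).
Proof. by case: hS => _ + _; apply. Qed.

Lemma sringM x y : S x -> S y -> S (x * y).
Proof. by case: hS => _ _ +; apply. Qed.

Lemma sring0 : S 0.
Proof. by rewrite -(subrr 1); exact: (sringB sring1 sring1). Qed.

Lemma sringN x : S x -> S (- x).
Proof. by move=> Sx; rewrite -sub0r; apply: sringB => //; exact: sring0. Qed.

Lemma sringD x y : S x -> S y -> S (x + y).
Proof. by move=> Sx Sy; rewrite -(opprK y); apply: sringB => //; exact: sringN.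
  Qed.

Lemma sring_sum (I : Type) (r : seq I) (P : pred I) (F : I -> A) :
  (forall i, P i -> S (F i)) -> S (\sum_(i <- r | P i) F i).
Proof. by move=> SF; apply: big_ind => //; [exact: sring0|exact: sringD]. Qed.

Lemma sring_prod (I : Type) (r : seq I) (P : pred I) (F : I -> A) :
  (forall i, P i -> S (F i)) -> S (\prod_(i <- r | P i) F i).
Proof. by move=> SF; apply: big_ind => [|x y|];
  [exact: sring1|exact: sringM|exact: SF]. Qed.

Lemma sring_sign k : S ((-1) ^+ k).
Proof.
elim: k => [|k IH]; first exact: sring1.
by rewrite exprS; apply: sringM => //; apply: sringN; exact: sring1.
Qed.

Definition entries_in m n (X : 'M[A]_(m, n)) := forall i j, S (X i j).

Lemma entries_in_mul m n p (X : 'M[A]_(m, n)) (Y : 'M[A]_(n, p)) :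
  entries_in X -> entries_in Y -> entries_in (X *m Y).
Proof. by move=> SX SY i j; rewrite mxE; apply: sring_sum => k _; exact: sringM.
  Qed.

Lemma sring_det n (X : 'M[A]_n) : entries_in X -> S (\det X).
Proof.
move=> SX; apply: sring_sum => s _; apply: sringM; first exact: sring_sign.
by apply: sring_prod => i _; exact: SX.
Qed.

Lemma sring_cofactor n (X : 'M[A]_n) i j : entries_in X -> S (cofactor X i j).
Proof.
move=> SX; apply: sringM; first exact: sring_sign.
by apply: sring_det => k l; rewrite !mxE; exact: SX.
Qed.

Lemma entries_in1 n : entries_in (1%:M : 'M[A]_n).
Proof. by move=> i j; rewrite mxE; case: eqP => _;
  [exact: sring1|exact: sring0]. Qed.

Lemma SLn_subgroup n : SL_subgroup S (SLn S n).
Proof.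
split=> //.
- by split; [exact: entries_in1|exact: det1].
- move=> M N [SM_ dM] [SN_ dN]; split; first exact: entries_in_mul.
  by rewrite det_mulmx dM dN mulr1.
- move=> M N [SM_ dM] MN1.
  (* The inverse is the adjugate, whose entries are signed minors and therefore stay in [S]. *)
  have -> : N = \adj M.
    by rewrite -[N]mul1mx -dM -mul_adj_mx -mulmxA MN1 mulmx1.
  split; first by move=> i j; rewrite mxE; exact: sring_cofactor.
  have := congr1 determinant (mul_adj_mx M).
  by rewrite det_mulmx dM mulr1 det1.
Qed.

Lemma SLn_elementary n (i j : 'I_n) a :
  i != j -> S a -> SLn S n (1%:M + a *: delta_mx i j).
Proof.
move=> ij Sa; split=> [k l|]; last exact: det_elementary.
rewrite !mxE; apply: sringD; first by case: eqP => _;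
  [exact: sring1|exact: sring0].
by apply: sringM => //; case: andP => _; [exact: sring1|exact: sring0].
Qed.

(** Since [SL_subgroup] asks for containment in [SLn], minimality is applied to the intersection of
    [SLn] with [P]. *)
Lemma En_ind n (P : set 'M[A]_n) :
  P 1%:M ->
  (forall i j a, i != j -> S a -> P (1%:M + a *: delta_mx i j)) ->
  (forall M N, P M -> P N -> P (M *m N)) ->
  (forall M N, P M -> M *m N = 1%:M -> P N) ->
  En S n `<=` P.
Proof.
move=> P1 Pe PM PV M EM; suff [] : (SLn S n `&` P) M by [].
apply: EM; split => /=.
  have [_ h1 h2 h3] := SLn_subgroup n.
  split=> [X []//|//|X Y|X Y].
  - by move=> [? ?] [? ?]; split; [exact: h2|exact: PM].
  - by move=> [? ?] XY; split; [exact: (h3 X)|exact: (PV X)].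
move=> _ [i [j [a ij [Sa ->]]]]; split; last exact: Pe.
exact: SLn_elementary.
Qed.

Lemma En_subgroup n : SL_subgroup S (En S n).
Proof.
have sub : En S n `<=` SLn S n.
  apply: smallest_sub; first exact: SLn_subgroup.
  by move=> _ [i [j [a ij [Sa ->]]]]; exact: SLn_elementary.
split=> //.
- by move=> H [[_ H1 _ _] _].
- by move=> M N EM EN H sH; have [[_ _ HM _] _] := sH; apply: HM;
  [exact: EM|exact: EN].
- by move=> M N EM MN H sH; have [[_ _ _ HV] _] := sH; apply: (HV M) => //;
  exact: EM.
Qed.

Lemma En_SLn n : En S n `<=` SLn S n. Proof. by have [] := En_subgroup n. Qed.

Lemma En1 n : En S n 1%:M. Proof. by have [] := En_subgroup n. Qed.

Lemma En_mul n M N : En S n M -> En S n N -> En S n (M *m N).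
Proof. by have [_ _ + _] := En_subgroup n; apply. Qed.

Lemma En_inv n M N : En S n M -> M *m N = 1%:M -> En S n N.
Proof. by have [_ _ _ +] := En_subgroup n; apply. Qed.

Lemma En_elementary n (i j : 'I_n) a :
  i != j -> S a -> En S n (1%:M + a *: delta_mx i j).
Proof. by move=> ij Sa; apply: sub_gen_smallest; exists i, j, a. Qed.
Lemma En_adj n (M : 'M[A]_n) : En S n M -> M *m \adj M = 1%:M.
Proof. by move=> /En_SLn[_ dM]; rewrite mul_mx_adj dM. Qed.

(** The inverses are carried as data: [A] has no inversion operation, and they too must lie in
    [S]. *)
Definition inv_diag n (d d' : 'rV[A]_n) :=
  forall i, [/\ S (d 0 i), S (d' 0 i) & d 0 i * d' 0 i = 1].

Lemma inv_diag_sym n (d d' : 'rV[A]_n) : inv_diag d d' -> inv_diag d' d.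
Proof. by move=> dd i; have [? ? e] := dd i; rewrite mulrC. Qed.

Lemma inv_diag_mul n (d d' : 'rV[A]_n) : inv_diag d d' ->
  diag_mx d *m diag_mx d' = 1%:M.
Proof.
move=> dd; rewrite mul_diag_mx; apply/matrixP => i j; rewrite !mxE.
by case: eqP => [->|_]; rewrite ?mulr0// mulr1n; have [_ _ ->] := dd j.
Qed.

(** Conjugation by a diagonal matrix only rescales the parameter of an elementary matrix, here by
    [d i * d' j]. *)
Lemma En_diag_conj n (d d' : 'rV[A]_n) M :
  inv_diag d d' -> En S n M -> En S n (diag_mx d *m M *m diag_mx d').
Proof.
move=> dd; have d1 := inv_diag_mul dd; have d2 :=
  inv_diag_mul (inv_diag_sym dd).
apply: (En_ind (P := [set M | En S n (diag_mx d *m M *m diag_mx d')])) => /=.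
- by rewrite mulmx1 d1; exact: En1.
- move=> i j a ij Sa.
  rewrite mulmxDr mulmx1 mulmxDl d1 -scalemxAr -scalemxAl.
  have -> : diag_mx d *m delta_mx i j *m diag_mx d' =
      (d 0 i * d' 0 j) *: delta_mx i j.
    apply/matrixP => k l; rewrite mul_mx_diag mul_diag_mx !mxE.
    by case: eqP => [->|_]; case: eqP => [->|_]; rewrite ?mulr0 ?mul0r ?mulr1.
  rewrite scalerA; apply: En_elementary => //.
  have [? _ _] := dd i; have [_ ? _] := dd j.
  by apply: sringM => //; exact: sringM.
- move=> X Y EX EY; have := En_mul EX EY.
  rewrite !mulmxA -(mulmxA (diag_mx d *m X)) d2 mulmx1.
  by [].
- move=> X Y EX XY; apply: (En_inv EX).
  by rewrite !mulmxA -(mulmxA (diag_mx d *m X)) d2 mulmx1 -(mulmxA _ X) XY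
    mulmx1.
Qed.

(** The group generated by elementary and diagonal matrices, in a normal form. Products keep this
    form because diagonal matrices normalize the elementary group ([En_diag_conj]). *)
Definition GEn n (X : 'M[A]_n) :=
  exists E d d', [/\ En S n E, inv_diag d d' & X = E *m diag_mx d].

Lemma GEn_En n X : En S n X -> GEn X.
Proof.
move=> EX; exists X, (const_mx 1), (const_mx 1); split=> //.
  by move=> i; rewrite !mxE mulr1; split=> //; exact: sring1.
by rewrite diag_const_mx mulmx1.
Qed.

Lemma GEn_diag n (d d' : 'rV[A]_n) : inv_diag d d' -> GEn (diag_mx d).
Proof.
by move=> dd; exists 1%:M, d, d'; split=> //; [exact: En1|rewrite mul1mx].
Qed.

Lemma GEn_mul n (X Y : 'M[A]_n) : GEn X -> GEn Y -> GEn (X *m Y).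
Proof.
move=> [E [d [d' [EE dd ->]]]] [F [f [f' [EF ff ->]]]].
exists (E *m (diag_mx d *m F *m diag_mx d')).
exists (\row_i (d 0 i * f 0 i)), (\row_i (d' 0 i * f' 0 i)); split.
- by apply: En_mul => //; exact: En_diag_conj.
- move=> i; rewrite !mxE; have [? ? e1] := dd i; have [? ? e2] := ff i.
  by split; [exact: sringM|exact: sringM|rewrite mulrACA e1 e2 mulr1].
- have -> : diag_mx (\row_i (d 0 i * f 0 i)) = diag_mx d *m diag_mx f.
    by apply/matrixP => i j; rewrite mul_diag_mx !mxE; case: eqP;
      rewrite ?mulr0.
  rewrite !mulmxA -(mulmxA (E *m _ *m F)) (inv_diag_mul (inv_diag_sym dd))
    mulmx1.
  by [].
Qed.

Lemma GEn_inv n (X : 'M[A]_n) : GEn X -> exists2 Y, GEn Y & X *m Y = 1%:M.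
Proof.
move=> [E [d [d' [EE dd ->]]]]; exists (diag_mx d' *m \adj E).
  apply: GEn_mul; first by exact/GEn_diag/inv_diag_sym.
  by apply: GEn_En; apply: (En_inv EE); exact: En_adj.
by rewrite mulmxA -(mulmxA E) (inv_diag_mul dd) mulmx1 En_adj.
Qed.

Lemma GEn_cancelr n (X Y : 'M[A]_n) : GEn X -> GEn (Y *m X) -> GEn Y.
Proof.
move=> /GEn_inv[Z HZ XZ] HYX; have := GEn_mul HYX HZ.
by rewrite -mulmxA XZ mulmx1.
Qed.

Lemma GEn_cancell n (X Y : 'M[A]_n) : GEn Y -> GEn (Y *m X) -> GEn X.
Proof.
move=> /GEn_inv[Z HZ YZ] HYX; have := GEn_mul HZ HYX.
by rewrite mulmxA (mulmx1C YZ) mul1mx.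
Qed.

Definition addrow n (i j : 'I_n) (a : A) (X : 'M[A]_n) : 'M[A]_n :=
  \matrix_(k, l) (X k l + (k == i)%:R * a * X j l).

Lemma En_addrow n (i j : 'I_n) a X :
  i != j -> S a -> En S n X -> En S n (addrow i j a X).
Proof.
move=> ij Sa EX; suff -> : addrow i j a X = (1%:M + a *: delta_mx i j) *m X.
  by apply: En_mul => //; exact: En_elementary.
rewrite mulmxDl mul1mx -scalemxAl; apply/matrixP => k l; rewrite !mxE.
congr (_ + _); rewrite (bigD1 j)//= big1 ?addr0 => [|m mj].
  by rewrite mxE eqxx andbT; case: eqP; rewrite ?mul1r ?mul0r ?mulr0.
by rewrite mxE (negbTE mj) andbF mul0r.
Qed.

(** Whitehead's word: the row operations with parameters [a], [- b], [a], alternately on rows [i]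
    and [j], compose to a weighted signed swap. *)
Lemma En_rowswap n (i j : 'I_n) a b X :
  i != j -> S a -> S b -> a * b = 1 -> En S n X ->
  En S n (\matrix_(k, l) (if k == i then a * X j l else
                          if k == j then - b * X i l else X k l)).
Proof.
move=> ij Sa Sb ab EX; have ji : j != i by rewrite eq_sym.
have := En_addrow ij Sa (En_addrow ji (sringN Sb) (En_addrow ij Sa EX)).
congr (En S n _); apply/matrixP => k l; rewrite !mxE.
have [->|ki] := eqVneq k i; rewrite ?eqxx ?(negbTE ij) ?(negbTE ji) /=.
  by ring: ab.
have [->|kj] := eqVneq k j; rewrite ?eqxx ?(negbTE ij) ?(negbTE ji) /=.
  by ring: ab.
by ring.
Qed.

(** Two swaps, with weights [b] and then [-1], put the rows back in place and leave the factors [a]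
    and [b]. *)
Lemma En_rowscale n (i j : 'I_n) a b X :
  i != j -> S a -> S b -> a * b = 1 -> En S n X ->
  En S n (\matrix_(k, l) (if k == i then a * X i l else
                          if k == j then b * X j l else X k l)).
Proof.
move=> ij Sa Sb ab EX; have ba : b * a = 1 by rewrite mulrC.
have N1 : (-1) * (-1) = 1 :> A by rewrite mulrNN mulr1.
have := En_rowswap ij (sringN sring1) (sringN sring1) N1
  (En_rowswap ij Sb Sa ba EX).
congr (En S n _); apply/matrixP => k l; rewrite !mxE !eqxx.
rewrite [j == i]eq_sym (negbTE ij).
by case: eqP => _; [|case: eqP => _ //]; ring.
Qed.

(** Induction on a list of places outside which [d] is 1. Merging two entries shortens the list; a
    single remaining entry equals the whole product, which is 1. *)
Lemma En_diag n (d d' : 'rV[A]_n) :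
  inv_diag d d' -> \prod_i d 0 i = 1 -> En S n (diag_mx d).
Proof.
move=> dd d1.
have diag1 (e : 'rV[A]_n) : (forall i, e 0 i = 1) -> En S n (diag_mx e).
  move=> e1; have -> : e = const_mx 1 by apply/rowP => i; rewrite e1 mxE.
  by rewrite diag_const_mx; exact: En1.
have [s] : exists s : seq 'I_n, forall i, i \notin s -> d 0 i = 1.
  by exists (enum 'I_n) => i; rewrite mem_enum.
elim: s d d' dd d1 => [|i s IH] d d' dd d1 ds; first by apply: diag1 => i;
  exact: ds.
case: s IH ds => [|j s] IH ds.
  apply: diag1 => k; have [->|ki] := eqVneq k i; last by apply: ds; rewrite inE.
  rewrite -d1 (bigD1 i)//= big1 ?mulr1// => l li; apply: ds; by rewrite inE.
have [ij|ij] := eqVneq i j.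
  apply: (IH d d') => // k ks; apply: ds; rewrite inE negb_or ks andbT.
  by rewrite ij; apply: contraNN ks => /eqP ->; rewrite inE eqxx.
(* The entry at [i] moves into the one at [j]; scaling row [i] by [d i] and row [j] by its inverse
   restores [d]. *)
pose f (e : 'rV[A]_n) :=
  \row_k (if k == i then 1 else if k == j then e 0 i * e 0 j
  else e 0 k).
have ff : inv_diag (f d) (f d').
  move=> k; rewrite !mxE; case: eqP => _; first by rewrite mulr1; split=> //;
    exact: sring1.
  have [? ? e1] := dd i; have [? ? e2] := dd j.
  case: eqP => _; last exact: dd.
  by split; [exact: sringM|exact: sringM|rewrite mulrACA e1 e2 mulr1].
have Ef : En S n (diag_mx (f d)).
  apply: (IH _ (f d')) => //.
    rewrite -[RHS]d1 (bigD1 i)//= (bigD1 j) 1?eq_sym//= [RHS](bigD1 i)//=.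
    rewrite [in RHS](bigD1 j) 1?eq_sym//= !mxE !eqxx.
    rewrite [j == i]eq_sym (negbTE ij) mul1r mulrA; congr (_ * _).
    by apply: eq_bigr => k /andP[ki kj]; rewrite mxE (negbTE ki) (negbTE kj).
  move=> k kjs; rewrite mxE; case: eqP => // /eqP ki.
  have kj : k != j by apply: contraNN kjs => /eqP ->; rewrite inE eqxx.
  by rewrite (negbTE kj); apply: ds; rewrite inE negb_or ki.
have [Si Si' ei] := dd i.
have := En_rowscale ij Si Si' ei Ef.
congr (En S n _); apply/matrixP => k l; rewrite !mxE !eqxx.
rewrite [j == i]eq_sym (negbTE ij).
case: eqP => [->|_]; first by rewrite mulrnAr mulr1.
case: eqP => [->|_] //; rewrite mulrnAr.
by congr (_ *+ _); ring: ei.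
Qed.

Lemma GEn_det1 n (X : 'M[A]_n) : GEn X -> \det X = 1 -> En S n X.
Proof.
move=> [E [d [d' [EE dd ->]]]]; rewrite det_mulmx.
have [_ ->] := En_SLn EE; rewrite mul1r det_diag => d1.
by apply: En_mul => //; exact: En_diag dd d1.
Qed.

Lemma En_lift n (X : 'M[A]_n) :
  En S n X -> En S (1 + n)%N (block_mx 1%:M 0 0 X).
Proof.
apply: (En_ind (P := [set X | En S (1 + n)%N (block_mx 1%:M 0 0 X)])) => /=.
- by rewrite -scalar_mx_block; exact: En1.
- move=> i j a ij Sa.
  have -> : block_mx 1%:M 0 0 (1%:M + a *: delta_mx i j) =
      1%:M + a *: delta_mx (rshift 1 i) (rshift 1 j) :> 'M[_]_(1 + n).
    rewrite delta_mx_dshift delta_mx_rshift scale_col_mx scale_row_mx !scaler0.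
    rewrite [1%:M in RHS]scalar_mx_block /block_mx add_col_mx !add_row_mx.
    by rewrite !addr0.
  by apply: En_elementary => //; rewrite (inj_eq (@rshift_inj _ _)).
- move=> M N EM EN; have := En_mul EM EN.
  by rewrite mulmx_block !mulmx0 !mul0mx !mulmx1 !addr0 add0r.
- move=> M N EM MN; apply: (En_inv EM).
  by rewrite mulmx_block !mulmx0 !mul0mx !mulmx1 !addr0 add0r MN
    -scalar_mx_block.
Qed.

Lemma En_lblock n (v : 'cV[A]_n) :
  entries_in v -> En S (1 + n)%N (block_mx 1%:M 0 v 1%:M).
Proof.
move=> Sv; rewrite [v]matrix_sum_delta.
have EnD (x y : 'cV[A]_n) : En S (1 + n)%N (block_mx 1%:M 0 x 1%:M) ->
    En S (1 + n)%N (block_mx 1%:M 0 y 1%:M) ->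
    En S (1 + n)%N (block_mx 1%:M 0 (x + y) 1%:M).
  move=> Ex Ey; have := En_mul Ex Ey.
  by rewrite mulmx_block !mulmx0 !mul0mx !mulmx1 !mul1mx !addr0 add0r.
apply: (big_ind (fun x => En S (1 + n)%N (block_mx 1%:M 0 x 1%:M))) => //.
  by rewrite -scalar_mx_block; exact: En1.
move=> i _; rewrite big_ord1.
have -> : block_mx 1%:M 0 (v i 0 *: delta_mx i 0) 1%:M =
    1%:M + v i 0 *: delta_mx (rshift 1 i) (lshift n 0) :> 'M[_]_(1 + n).
  rewrite delta_mx_dshift delta_mx_lshift scale_col_mx scale_row_mx !scaler0.
  rewrite [1%:M in RHS]scalar_mx_block /block_mx add_col_mx !add_row_mx.
  by rewrite !addr0 !add0r.
by apply: En_elementary => //; rewrite eq_rlshift.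
Qed.

Lemma En_tr n (M : 'M[A]_n) : En S n M -> En S n M^T.
Proof.
apply: (En_ind (P := [set X | En S n X^T])) => /=.
- by rewrite trmx1; exact: En1.
- move=> i j a ij Sa; rewrite linearD linearZ /= trmx1 trmx_delta.
  by apply: En_elementary => //; rewrite eq_sym.
- by move=> X Y EX EY; rewrite trmx_mul; exact: En_mul.
- by move=> X Y EX /mulmx1C YX; apply: (En_inv EX); rewrite -trmx_mul YX trmx1.
Qed.

Lemma En_ublock n (v : 'rV[A]_n) :
  entries_in v -> En S (1 + n)%N (block_mx 1%:M v 0 1%:M).
Proof.
move=> Sv; have /En_lblock/En_tr : entries_in v^T by move=> i j; rewrite mxE.
by rewrite tr_block_mx !trmx1 trmx0 trmxK.
Qed.

Lemma GEn_lift n a a' (X : 'M[A]_n) : S a -> S a' -> a * a' = 1 -> GEn X ->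
  GEn (block_mx a%:M 0 0 X : 'M[A]_(1 + n)).
Proof.
move=> Sa Sa' aa' [E [d [d' [EE dd ->]]]].
exists (block_mx 1%:M 0 0 E), (row_mx a%:M d), (row_mx a'%:M d'); split.
- exact: En_lift.
- move=> i; rewrite !mxE; case: fintype.split => j; last exact: dd.
  by rewrite !ord1 !mxE.
- rewrite diag_mx_row mulmx_block !mulmx0 !mul0mx !addr0 add0r mul1mx.
  by congr block_mx; apply/matrixP => i j; rewrite !mxE !ord1 mulr1n.
Qed.

Lemma GEn_block n a a' (b : 'rV[A]_n) (c : 'cV[A]_n) (d : 'M[A]_n) :
  S a -> S a' -> a * a' = 1 -> entries_in b -> entries_in c ->
  GEn (d - a' *: (c *m b)) -> GEn (block_mx a%:M b c d : 'M[A]_(1 + n)).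
Proof.
move=> Sa Sa' aa' Sb Sc Hd; rewrite (block_LDU _ _ _ aa').
apply: GEn_mul; last by apply: GEn_En; apply: En_ublock => i j; rewrite mxE;
  exact: sringM.
apply: GEn_mul; first by apply: GEn_En; apply: En_lblock => i j; rewrite mxE;
  exact: sringM.
exact: (GEn_lift Sa Sa' aa' Hd).
Qed.

(** Gaussian elimination over a field, whose nonzero elements become units of [S]. It serves for the
    constant matrix at the end of the path. *)
Lemma GEn_unitmx (F : fieldType) (phi : {rmorphism F -> A}) n (X : 'M[F]_n) :
  (forall x, S (phi x)) -> X \in unitmx -> GEn (map_mx phi X).
Proof.
move=> Sphi; elim: n X => [|n IH] X Xu.
  have -> : map_mx phi X = 1%:M by apply/matrixP => -[].
  by apply: GEn_En; exact: En1.
have pivot (Y : 'M[F]_(1 + n)) : Y \in unitmx -> Y 0 0 != 0 ->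
    GEn (map_mx phi Y).
  move=> Yu Y0; pose a := Y 0 0; have aV : a * a^-1 = 1 by rewrite divff.
  have eY : Y = block_mx a%:M (ursubmx Y) (dlsubmx Y) (drsubmx Y).
    rewrite -[LHS]submxK; congr block_mx; apply/matrixP => i j.
    by rewrite !ord1 !mxE mulr1n; congr (Y _ _); apply: val_inj.
  rewrite eY map_block_mx map_scalar_mx;
    apply: (@GEn_block _ _ (phi a^-1)) => //.
  - by rewrite -rmorphM aV rmorph1.
  - by move=> i j; rewrite mxE.
  - by move=> i j; rewrite mxE.
  - rewrite -map_mxM -map_mxZ -map_mxB; apply: IH.
    move: Yu; rewrite {1}eY (block_LDU _ _ _ aV) !unitmxE !det_mulmx.
    rewrite det_lblock !det_ublock !det1 !mul1r mulr1.
    by rewrite unitrM => /andP[].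
have [i Xi0] : exists i : 'I_n.+1, X i 0 != 0.
  apply/existsP; apply: contraTT Xu; rewrite negb_exists => /forallP X0.
  rewrite unitmxE (expand_det_col _ 0) big1 ?unitr0// => i _.
  by have /negPn/eqP -> := X0 i; rewrite mul0r.
have [X00|X00] := eqVneq (X 0 0) 0; last exact: pivot.
have i0 : 0 != i by apply: contraNneq Xi0 => <-; rewrite X00.
(* Adding row [i], whose first entry is nonzero, to row 0 creates a nonzero pivot. *)
pose U : 'M[F]_n.+1 := 1%:M + delta_mx 0 i.
have U1 : \det U = 1 by rewrite -(det_elementary 1 i0) scale1r.
apply: (@GEn_cancell _ _ (map_mx phi U)).
  rewrite map_mxD map_mx1 map_delta_mx -[delta_mx _ _]scale1r.
  by apply: GEn_En; apply: En_elementary => //; exact: sring1.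
rewrite -map_mxM; apply: pivot.
  by rewrite unitmx_mul Xu andbT unitmxE U1 unitr1.
rewrite mulmxDl mul1mx mxE X00 add0r mxE (bigD1 i)//= big1 ?addr0 => [|j ji].
  by rewrite mxE !eqxx mul1r.
by rewrite mxE (negbTE ji) andbF mul0r.
Qed.

End ElementaryMatrices.

(** * Trigonometric sums and their means *)

Local Open Scope complex_scope.

Section NormC.
Variable R : rcfType.
Implicit Types z w : R[i].

Lemma normc_ge0 z : 0 <= normc z.
Proof. by case: z => a b; exact: sqrtr_ge0. Qed.

Lemma normcR (a : R) : normc a%:C = `|a|.
Proof. by rewrite /normc /= expr0n addr0 sqrtr_sqr. Qed.

Lemma Re_le_normc z : complex.Re z <= normc z.
Proof.
case: z => a b /=; apply: (le_trans (ler_norm _)).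
by rewrite -sqrtr_sqr ler_sqrt ?addr_ge0 ?sqr_ge0// lerDl sqr_ge0.
Qed.

Lemma Im_le_normc z : complex.Im z <= normc z.
Proof.
case: z => a b /=; apply: (le_trans (ler_norm _)).
by rewrite -sqrtr_sqr ler_sqrt ?addr_ge0 ?sqr_ge0// lerDr sqr_ge0.
Qed.

Lemma normc_le_ReIm z : normc z <= `|complex.Re z| + `|complex.Im z|.
Proof.
case: z => a b /=; rewrite -[leRHS]ger0_norm ?addr_ge0// -[leRHS]sqrtr_sqr.
rewrite ler_sqrt ?sqr_ge0// sqrrD !real_normK ?num_real//.
by rewrite -addrA lerD2l lerDr mulrn_wge0// mulr_ge0.
Qed.

Lemma cReD z w : complex.Re (z + w) = complex.Re z + complex.Re w.
Proof. by case: z w => [a b] [c d]. Qed.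

Lemma cImD z w : complex.Im (z + w) = complex.Im z + complex.Im w.
Proof. by case: z w => [a b] [c d]. Qed.

Lemma cReB z w : complex.Re (z - w) = complex.Re z - complex.Re w.
Proof. by case: z w => [a b] [c d]. Qed.

Lemma cImB z w : complex.Im (z - w) = complex.Im z - complex.Im w.
Proof. by case: z w => [a b] [c d]. Qed.

Lemma cReM z w : complex.Re (z * w) =
  complex.Re z * complex.Re w - complex.Im z * complex.Im w.
Proof. by case: z w => [a b] [c d]. Qed.

Lemma cImM z w : complex.Im (z * w) =
  complex.Re z * complex.Im w + complex.Im z * complex.Re w.
Proof. by case: z w => [a b] [c d]. Qed.

Lemma normc_sqr z : normc z ^+ 2 = complex.Re z ^+ 2 + complex.Im z ^+ 2.
Proof. by case: z => a b; rewrite /normc sqr_sqrtr ?addr_ge0 ?sqr_ge0. Qed.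

Lemma normcX z k : normc (z ^+ k) = normc z ^+ k.
Proof. by elim: k => [|k IH]; rewrite ?normc1// !exprS normcM IH. Qed.

Lemma le_normc_sum (I : Type) (r : seq I) (P : pred I) (F : I -> R[i]) :
  normc (\sum_(i <- r | P i) F i) <= \sum_(i <- r | P i) normc (F i).
Proof.
apply: (big_ind2 (fun z a => normc z <= a)) => [|z a w b za wb|//].
  by rewrite normc0.
by apply: (le_trans (le_normcD _ _)); exact: lerD.
Qed.

(** Rotating by [u] turns a bound on a modulus into a bound on a real part. *)
Lemma normc_rot z : exists2 u : R[i], normc u = 1 & u * z = (normc z)%:C.
Proof.
have [->|z0] := eqVneq z 0.
  by exists 1; rewrite ?normc1// mulr0 normc0.
have nz : normc z != 0 by apply: contraNneq z0 => /eq0_normc ->.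
exists ((normc z)%:C * z^-1); last by rewrite -mulrA mulVf// mulr1.
by rewrite normcM normcV normcR ger0_norm ?normc_ge0// divff.
Qed.

End NormC.

Section TrigPoly.
Variable R : realType.
Local Notation C := R[i].
Local Notation mu := (@lebesgue_measure R).

Definition eix (l x : R) : C := cos (l * x) +i* sin (l * x).

Lemma eixD l m x : eix (l + m) x = eix l x * eix m x.
Proof.
apply/eqP; rewrite eq_complex cReM cImM /= mulrDl cosD sinD eqxx /=.
by apply/eqP; ring.
Qed.

Lemma eix0 x : eix 0 x = 1.
Proof. by rewrite /eix mul0r cos0 sin0. Qed.

Lemma eix_sub l x t : eix l (x - t) = eix l x * eix (- l) t.
Proof.
apply/eqP; rewrite eq_complex cReM cImM /= mulrBr mulNr cosB sinB cosN sinN.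
by rewrite mulrN opprK eqxx /=; apply/eqP; ring.
Qed.

Lemma normc_eix l x : normc (eix l x) = 1.
Proof. by rewrite /eix /normc cos2Dsin2 sqrtr1. Qed.

(** A finite sum of [c * e^(i l x)] is encoded by the list of its [(c, l)];
    frequencies may be repeated. *)
Definition tpoly := seq (C * R).
Implicit Types s k q : tpoly.

Definition tp s (x : R) : C := \sum_(t <- s) t.1 * eix t.2 x.
Definition coef s (l : R) : C := \sum_(t <- s | t.2 == l) t.1.
Definition tmul s s' : tpoly := [seq (a.1 * b.1, a.2 + b.2) | a <- s, b <- s'].
Definition tscale c s : tpoly := [seq (c * a.1, a.2) | a <- s].

Lemma tp_cat s s' x : tp (s ++ s') x = tp s x + tp s' x.
Proof. by rewrite /tp big_cat. Qed.

Lemma tp_scale c s x : tp (tscale c s) x = c * tp s x.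
Proof. by rewrite /tp big_map mulr_sumr; apply: eq_bigr => t _; rewrite mulrA.
  Qed.

Lemma tp_mul s s' x : tp (tmul s s') x = tp s x * tp s' x.
Proof.
rewrite /tp big_allpairs_dep mulr_suml; apply: eq_bigr => a _.
rewrite mulr_sumr; apply: eq_bigr => b _.
by rewrite eixD mulrACA.
Qed.

Lemma coef_cat s s' l : coef (s ++ s') l = coef s l + coef s' l.
Proof. by rewrite /coef big_cat. Qed.

Lemma coef_scale c s l : coef (tscale c s) l = c * coef s l.
Proof. by rewrite /coef big_map mulr_sumr. Qed.

Lemma tmul_cons a s s' : tmul (a :: s) s' =
  [seq (a.1 * b.1, a.2 + b.2) | b <- s'] ++ tmul s s'.
Proof. by []. Qed.

Lemma coef_mul1 a s l :
  coef [seq (a.1 * b.1, a.2 + b.2) | b <- s] l = a.1 * coef s (l - a.2).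
Proof.
rewrite /coef big_map mulr_sumr; apply: eq_bigl => b /=.
by rewrite eq_sym addrC -subr_eq eq_sym.
Qed.

(** A primitive of the real part of [tp s]. The terms of frequency 0 are set apart: they are the
    only ones with an unbounded primitive. *)
Definition tprim s (x : R) : R := \sum_(t <- s)
  (if t.2 == 0 then complex.Re t.1 * x else
    (complex.Re t.1 * sin (t.2 * x) + complex.Im t.1 * cos (t.2 * x)) / t.2).

Lemma tp_nil x : tp [::] x = 0. Proof. by rewrite /tp big_nil. Qed.

Lemma tp_cons t s x : tp (t :: s) x = t.1 * eix t.2 x + tp s x.
Proof. by rewrite /tp big_cons. Qed.

Lemma is_derive_tprim s (x : R) : is_derive x 1 (tprim s) (complex.Re (tp s x)).
Proof.
elim: s => [|t s IH].
  have -> : tprim [::] = cst 0 by apply/funext => y; rewrite /tprim big_nil.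
  by rewrite tp_nil; exact: is_derive_cst.
have -> : tprim (t :: s) = (fun y => if t.2 == 0 then complex.Re t.1 * y else
    (complex.Re t.1 * sin (t.2 * y) + complex.Im t.1 * cos (t.2 * y)) / t.2) \+
      tprim s.
  by apply/funext => y; rewrite /tprim big_cons.
rewrite tp_cons cReD cReM /=; case: eqP => [t0|/eqP t0].
  rewrite t0 mul0r cos0 sin0 mulr1 mulr0 subr0.
  apply: is_deriveD.
  apply: is_derive_eq.
  by rewrite scaler1.
have dl : is_derive x 1 ( *%R t.2 ) t.2.
  by apply: is_derive_eq; rewrite scaler1.
have ds : is_derive x 1 (sin \o *%R t.2) (cos (t.2 * x) * t.2).
  exact: is_derive1_comp.
have dc : is_derive x 1 (cos \o *%R t.2) (- sin (t.2 * x) * t.2).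
  exact: is_derive1_comp.
apply: is_deriveD.
have -> : (fun y =>
  (complex.Re t.1 * sin (t.2 * y) + complex.Im t.1 * cos (t.2 * y)) / t.2) =
    t.2^-1 *: (complex.Re t.1 *: (sin \o *%R t.2) +
      complex.Im t.1 *: (cos \o *%R t.2)).
  by apply/funext => y; rewrite mulrC.
apply: is_derive_eq; rewrite !scalerA; rewrite /GRing.scale /=.
by field.
Qed.

Lemma continuous_Re_tp s : continuous (fun x => complex.Re (tp s x)).
Proof.
elim: s => [|t s IH].
  rewrite (_ : (fun x => _) = cst 0); first exact: cst_continuous.
  by apply/funext => y; rewrite tp_nil.
rewrite (_ : (fun x => _) = (fun x => complex.Re t.1 * cos (t.2 * x) -
   complex.Im t.1 * sin (t.2 * x)) \+ (fun x => complex.Re (tp s x))).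
  move=> x; apply: continuousD; last exact: IH.
  by apply: continuousB; apply: continuousM; try exact: cst_continuous;
    apply: continuous_comp; try exact: mulrl_continuous;
    [exact: continuous_cos|exact: continuous_sin].
by apply/funext => y; rewrite tp_cons cReD cReM.
Qed.

Lemma Rintegral_tp s (r : R) : 0 < r ->
  \int[mu]_(x in `[- r, r]) complex.Re (tp s x) = tprim s r - tprim s (- r).
Proof.
move=> r0; rewrite /Rintegral (@continuous_FTC2 _ _ (tprim s)) ?gtrN//.
- by apply: continuous_subspaceT; exact: continuous_Re_tp.
- split=> [x _||].
  + by have [] := is_derive_tprim s x.
  + apply: cvg_at_right_filter; apply: differentiable_continuous.
    by apply/derivable1_diffP; have [] := is_derive_tprim s (- r).
  + apply: cvg_at_left_filter; apply: differentiable_continuous.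
    by apply/derivable1_diffP; have [] := is_derive_tprim s r.
- by move=> x _; rewrite derive1E; have [_ ->] := is_derive_tprim s x.
Qed.

(** Terms of nonzero frequency have bounded primitives, so the integral over [[- r, r]] is [2 r]
    times the real part of [coef s 0], up to an error independent of [r]. *)
Lemma tprim_bound s : exists2 K : R, 0 <= K & forall r,
  `|tprim s r - tprim s (- r) - r * 2 * complex.Re (coef s 0)| <= K.
Proof.
elim: s => [|t s [K K0 IH]].
  by exists 0 => // r; rewrite /tprim /coef !big_nil subrr mulr0 subr0 normr0.
pose L := `|complex.Re t.1 * 2 / t.2|.
exists (L + K); first by rewrite addr_ge0 // normr_ge0.
move=> r; rewrite /tprim /coef !big_cons -/(coef s 0) -/(tprim s r)
  -/(tprim s (- r)).
set F := (if _ then _ else _); set G := (if _ then _ else _).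
suff FG : `|F - G - r * 2 * (if t.2 == 0 then complex.Re t.1 else 0)| <= L.
  have -> : F + tprim s r - (G + tprim s (- r)) -
      r * 2 * complex.Re (if t.2 == 0 then t.1 + coef s 0 else coef s 0) =
    (F - G - r * 2 * (if t.2 == 0 then complex.Re t.1 else 0)) +
    (tprim s r - tprim s (- r) - r * 2 * complex.Re (coef s 0)).
    by case: eqP => _; rewrite ?cReD; ring.
  by apply: (le_trans (ler_normD _ _)); apply: lerD.
rewrite /F /G; case: eqP => [t0|t0].
  by rewrite (_ : _ - _ = 0) ?normr0 /L ?normr_ge0//; ring.
rewrite mulrN sinN cosN mulr0 subr0 /L.
have -> : (complex.Re t.1 * sin (t.2 * r) + complex.Im t.1 * cos (t.2 * r)) /
  t.2 -
   (complex.Re t.1 * - sin (t.2 * r) + complex.Im t.1 * cos (t.2 * r)) / t.2 =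
   complex.Re t.1 * 2 / t.2 * sin (t.2 * r) by field; apply/eqP.
by rewrite normrM -[leRHS]mulr1 ler_wpM2l// sin_max.
Qed.

Lemma mean_ge0 s :
  {ae mu, forall x, 0 <= complex.Re (tp s x)} -> 0 <= complex.Re (coef s 0).
Proof.
have aeF := ae_filter_ringOfSetsType mu.
move=> s0; rewrite leNgt; apply/negP => c0.
have [K K0 HK] := tprim_bound s.
pose c := complex.Re (coef s 0).
(* With this [r] the main term [2 r c] is [- (K + 1)], and an error of at most [K] cannot make the
   integral nonnegative. *)
pose r := (K + 1) / (2 * - c).
have r0 : 0 < r by rewrite divr_gt0 ?mulr_gt0 ?oppr_gt0// ltr_wpDl.
have I0 : 0 <= \int[mu]_(x in `[- r, r]) complex.Re (tp s x).
  have mf : measurable_fun `[- r, r] (fun x => (complex.Re (tp s x))%:E).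
    apply/measurable_EFinP; apply: measurable_funTS.
    apply: continuous_measurable_fun; exact: continuous_Re_tp.
  apply: fine_ge0.
  suff -> : (\int[mu]_(x in `[(- r)%R, r]) (complex.Re (tp s x))%:E =
      \int[mu]_(x in `[(- r)%R, r]) `|(complex.Re (tp s x))%:E|)%E.
    exact: integral_ge0.
  apply: ae_eq_integral => //; first exact: measurableT_comp.
  by apply: filterS s0 => x fx _ /=; rewrite ger0_norm.
move: I0; rewrite Rintegral_tp// => I0.
have := HK r; rewrite ler_norml => /andP[_].
have -> : r * 2 * complex.Re (coef s 0) = - (K + 1).
  by rewrite /r -/c; field; rewrite lt_eqF.
by move=> h; lra.
Qed.

(** Positivity of the mean is applied to [k - u q], where the phase [u] makes [u * coef q 0] equal
    to its modulus. *)
Lemma mean_bound q k :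
  {ae mu, forall x, normc (tp q x) <= complex.Re (tp k x)} ->
  normc (coef q 0) <= complex.Re (coef k 0).
Proof.
have aeF := ae_filter_ringOfSetsType mu.
move=> qk; have [u u1 uq] := normc_rot (coef q 0).
suff : 0 <= complex.Re (coef (k ++ tscale (- u) q) 0).
  by rewrite coef_cat coef_scale cReD mulNr uq raddfN subr_ge0.
apply: mean_ge0; apply: filterS qk => x qk.
rewrite tp_cat tp_scale cReD mulNr raddfN subr_ge0; apply: le_trans qk.
by rewrite -[leRHS]mul1r -u1 -normcM; exact: Re_le_normc.
Qed.

(** Multiplication by [e^(- i l x)] preserves moduli and brings the coefficient of index [l] to
    frequency 0, where it is a mean. *)
Lemma coef_bound s B l :
  {ae mu, forall x, normc (tp s x) <= B} -> normc (coef s l) <= B.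
Proof.
have aeF := ae_filter_ringOfSetsType mu.
move=> sB.
have -> : coef s l = coef (tmul [:: (1, - l)] s) 0.
  rewrite tmul_cons coef_cat coef_mul1 mul1r sub0r opprK.
  by rewrite [X in _ + X]/coef big_nil addr0.
have -> : B = complex.Re (coef [:: (B%:C, 0)] 0).
  by rewrite /coef big_cons eqxx big_nil addr0.
apply: mean_bound.
apply: filterS sB => x sB.
by rewrite tp_mul !tp_cons !tp_nil !addr0 eix0 mulr1 mul1r normcM normc_eix
  mul1r.
Qed.

Definition tpow s (k : nat) : tpoly := iter k (tmul s) [:: (1, 0)].

Lemma tp_pow s (k : nat) x : tp (tpow s k) x = tp s x ^+ k.
Proof.
elim: k => [|k IH]; first by rewrite tp_cons tp_nil addr0 eix0 mulr1.
by rewrite /tpow iterS tp_mul -/(tpow s k) IH exprS.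
Qed.

Definition freqs s : seq R := [seq t.2 | t <- s].

Definition twist (m : R -> R) s : tpoly :=
  [seq (t.1 * (m t.2)%:C, t.2) | t <- s].

(** The domain [D] matters for [zero_mult], the indicator of frequency 0: it is multiplicative on
    nonnegative frequencies but fails to be so on opposite ones. *)
Definition multiplicative_on (D : set R) (m : R -> R) :=
  [/\ D 0, forall l l', D l -> D l' -> D (l + l'), m 0 = 1 &
      forall l l', D l -> D l' -> m (l + l') = m l * m l'].

Definition tpoly_on (D : set R) s := forall t, t \in s -> D t.2.

Lemma tpoly_on_mul D s s' : (forall l l', D l -> D l' -> D (l + l')) ->
  tpoly_on D s -> tpoly_on D s' -> tpoly_on D (tmul s s').
Proof.
by move=> DD Ds Ds' _ /allpairsP[[a b] [/= /Ds Da /Ds' Db ->]]; exact: DD.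
Qed.

Lemma twist_mul D m s s' : multiplicative_on D m -> tpoly_on D s ->
  tpoly_on D s' -> twist m (tmul s s') = tmul (twist m s) (twist m s').
Proof.
move=> [_ _ _ mM] Ds Ds';
  rewrite /twist /tmul map_allpairs allpairs_mapl allpairs_mapr.
apply/eq_in_allpairs => a b /Ds Da /Ds' Db /=.
by rewrite mM// rmorphM /= mulrACA.
Qed.

Lemma twist_pow D m s (k : nat) : multiplicative_on D m -> tpoly_on D s ->
  tpoly_on D (tpow s k) /\ twist m (tpow s k) = tpow (twist m s) k.
Proof.
move=> Dm Ds; have [D0 DD m0 mM] := Dm; elim: k => [|k [IH1 IH2]].
  split; first by move=> t; rewrite inE => /eqP ->.
  by rewrite /tpow /= /twist /= m0 mulr1.
rewrite /tpow !iterS; split; first exact: tpoly_on_mul.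
by rewrite (twist_mul Dm)// IH2.
Qed.

(** After grouping, the number of terms is the number of distinct frequencies, which grows only
    polynomially for the powers of a sum. *)
Lemma sum_by_freq s (f : R -> C) :
  \sum_(t <- s) t.1 * f t.2 = \sum_(l <- undup (freqs s)) coef s l * f l.
Proof.
under [RHS]eq_bigr => l _ do rewrite mulr_suml.
rewrite (exchange_big_dep predT)//= big_seq [RHS]big_seq;
  apply: eq_bigr => t ts.
rewrite [RHS]big_mkcond (bigD1_seq t.2) ?undup_uniq//=;
  last by rewrite mem_undup map_f.
by rewrite eqxx big1 ?addr0// => l; rewrite eq_sym; case: eqP.
Qed.

(** Each frequency receives a multiplicity between 0 and [k], independently of the others. This
    contains all sums of [k] frequencies and has a size polynomial in [k]. *)
Fixpoint pow_freqs (F : seq R) (k : nat) : seq R :=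
  if F is l :: F' then [seq l *+ a + m | a <- iota 0 k.+1, m <- pow_freqs F' k]
  else [:: 0].

Arguments pow_freqs : simpl never.

Lemma pow_freqs_cons l F (k : nat) :
  pow_freqs (l :: F) k =
    [seq l *+ a + m | a <- iota 0 k.+1, m <- pow_freqs F k].
Proof. by []. Qed.

Lemma size_pow_freqs F (k : nat) : size (pow_freqs F k) = (k.+1 ^ size F)%N.
Proof. by elim: F => // l F IH;
  rewrite pow_freqs_cons size_allpairs size_iota IH expnS. Qed.

Lemma pow_freqs_S F (k : nat) : {subset pow_freqs F k <= pow_freqs F k.+1}.
Proof.
elim: F => // l F IH x; rewrite !pow_freqs_cons.
move=> /allpairsP[[a m] [+ mF ->]]; rewrite mem_iota add0n => /andP[_ ak].
apply/allpairsP; exists (a, m); split; [|exact: IH|by []].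
by rewrite mem_iota add0n (leq_trans ak).
Qed.

Lemma pow_freqs_D F (k : nat) l m :
  l \in F -> m \in pow_freqs F k -> l + m \in pow_freqs F k.+1.
Proof.
elim: F m => // l' F IH x /[swap]; rewrite !pow_freqs_cons.
move=> /allpairsP[[a m] [+ mF ->]]; rewrite mem_iota add0n inE => /andP[_ ak].
case/predU1P => [->|lF]; apply/allpairsP.
  exists (a.+1, m); split.
  - by rewrite mem_iota.
  - exact: pow_freqs_S.
  - by rewrite mulrS addrA.
exists (a, l + m); split.
- by rewrite mem_iota add0n (leq_trans ak).
- exact: IH.
- by rewrite addrCA.
Qed.

Lemma freqs_pow s (k : nat) :
  {subset freqs (tpow s k) <= pow_freqs (freqs s) k}.
Proof.
elim: k => [|k IH] l.
  rewrite inE => /eqP -> ; elim: (freqs s) => [|m F IH].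
    by rewrite /pow_freqs mem_seq1.
  rewrite pow_freqs_cons.
  by apply/allpairsP; exists (0%N, 0); rewrite mulr0n addr0; split=> //;
    rewrite mem_iota.
rewrite /tpow iterS => /mapP[_ /allpairsP[[a b] [/= as_ bs ->]] ->] /=.
by apply: pow_freqs_D; [exact: map_f|apply: IH; exact: map_f].
Qed.

Lemma size_freqs_pow s (k : nat) :
  (size (undup (freqs (tpow s k))) <= k.+1 ^ size s)%N.
Proof.
rewrite -[size s](size_map snd) -size_pow_freqs; apply: uniq_leq_size.
  exact: undup_uniq.
by move=> l; rewrite mem_undup; exact: freqs_pow.
Qed.

End TrigPoly.

(** * Exponential against polynomial growth *)

Section Growth.
Variable R : realType.

Lemma bernoulli_ineq (d : R) k : 0 <= d -> 1 + k%:R * d <= (1 + d) ^+ k.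
Proof.
move=> d0; elim: k => [|k IH]; first by rewrite mul0r addr0.
rewrite exprS; apply: (@le_trans _ _ ((1 + d) * (1 + k%:R * d))); last first.
  by rewrite ler_wpM2l// addr_ge0.
rewrite -natr1 -subr_ge0 (_ : _ - _ = k%:R * d ^+ 2); last by ring.
by rewrite mulr_ge0// sqr_ge0.
Qed.

(** With [d = x - 1] and [k = j (n + 1)], Bernoulli's inequality gives [x ^ k >= (j d) ^ (n + 1)],
    while [k + 1 <= j (n + 2)]. Hence [j d ^ (n + 1) > (n + 2) ^ n] suffices. *)
Lemma exp_gt_pow (x : R) n : 1 < x -> exists k, k.+1%:R ^+ n < x ^+ k.
Proof.
move=> x1; pose d := x - 1; have d0 : 0 < d by rewrite subr_gt0.
have dN0 : 0 < d ^+ n.+1 by rewrite exprn_gt0.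
have [j jd] : exists j : nat, (n.+2)%:R ^+ n / d ^+ n.+1 < j%:R.
  by exists (Num.truncn ((n.+2)%:R ^+ n / d ^+ n.+1)).+1; exact: truncnS_gt.
have j0 : (0 < j)%N.
  rewrite -(ltr_nat R); apply: le_lt_trans jd.
  by rewrite divr_ge0// exprn_ge0// ltW.
exists (j * n.+1)%N; rewrite exprM.
apply: (@lt_le_trans _ _ ((j%:R * d) ^+ n.+1)); last first.
  have jdge : 0 <= j%:R * d by rewrite mulr_ge0// ltW.
  apply: lerXn2r; rewrite ?nnegrE ?exprn_ge0// ?(le_trans _ (ltW x1))//.
  rewrite -[x](addrNK 1) [_ + 1]addrC -/d.
  by apply: le_trans (bernoulli_ineq j (ltW d0)); rewrite lerDr.
apply: (@le_lt_trans _ _ ((j * n.+2)%:R ^+ n)).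
  apply: lerXn2r; rewrite ?nnegrE ?ler0n// ler_nat.
  by rewrite [(j * n.+2)%N]mulnS -add1n leq_add2r.
rewrite natrM !exprMn [j%:R ^+ n.+1]exprSr -mulrA.
rewrite ltr_pM2l ?exprn_gt0 ?ltr0n//.
by move: jd; rewrite ltr_pdivrMr.
Qed.

(** The tensor power trick: if [a > B > 0], then [(a / B) ^ k] outgrows the polynomial factor; for
    [B = 0] the exponent 1 decides. *)
Lemma le_of_pow_bound (a B : R) n : 0 <= a -> 0 <= B ->
  (forall k, a ^+ k <= k.+1%:R ^+ n * B ^+ k) -> a <= B.
Proof.
move=> a0 B0 aB; rewrite leNgt; apply/negP => Ba.
have [B00|Bn0] := eqVneq B 0.
  by have := aB 1%N; rewrite B00 !expr1 mulr0 leNgt -B00 Ba.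
have Bp : 0 < B by rewrite lt_neqAle eq_sym Bn0.
have [k] : exists k, k.+1%:R ^+ n < (a / B) ^+ k.
  by apply: exp_gt_pow; rewrite ltr_pdivlMr// mul1r.
rewrite expr_div_n ltr_pdivlMr ?exprn_gt0// ltNge => /negP; apply.
exact: aB.
Qed.

End Growth.

(** * A Bochner-Fejer kernel *)

Section Kernel.
Variable R : realType.
Local Notation C := R[i].
Local Notation mu := (@lebesgue_measure R).
Implicit Types s k q : tpoly R.

Lemma twist_sup (D : set R) m s B x : multiplicative_on D m ->
  (forall l, D l -> `|m l| <= 1) -> tpoly_on D s ->
  {ae mu, forall y, normc (tp s y) <= B} -> normc (tp (twist m s) x) <= B.
Proof.
have aeF := ae_filter_ringOfSetsType mu.
move=> Dm m1 Ds sB.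
have B0 : 0 <= B by apply: le_trans (coef_bound 0 sB); exact: normc_ge0.
apply: (@le_of_pow_bound _ _ _ (size s)) => //; first exact: normc_ge0.
move=> N; have [DsN twN] := twist_pow N Dm Ds.
rewrite -normcX -tp_pow -twN.
have -> : tp (twist m (tpow s N)) x =
    \sum_(t <- tpow s N) t.1 * ((m t.2)%:C * eix t.2 x).
  by rewrite /tp big_map; apply: eq_bigr => t _; rewrite mulrA.
rewrite (sum_by_freq _ (fun l => (m l)%:C * eix l x)).
apply: (le_trans (le_normc_sum _ _ _)).
apply: (@le_trans _ _ (\sum_(l <- undup (freqs (tpow s N))) B ^+ N)).
  rewrite big_seq [leRHS]big_seq; apply: ler_sum => l; rewrite mem_undup.
  move=> /mapP[t /DsN Dt ->]; rewrite !normcM normc_eix mulr1 normcR.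
  rewrite -[leRHS]mulr1; apply: ler_pM => //; first exact: normc_ge0.
    apply: coef_bound; apply: filterS sB => y sB.
    by rewrite tp_pow normcX; apply: lerXn2r => //; rewrite nnegrE ?normc_ge0.
  exact: m1.
rewrite big_const_seq count_predT iter_addr_0 -[leLHS]mulr_natl.
apply: ler_wpM2r; first exact: exprn_ge0.
by rewrite -natrX ler_nat size_freqs_pow.
Qed.

Lemma twist1 s : twist (fun=> 1) s = s.
Proof. by rewrite -[RHS]map_id; apply: eq_map => -[c l] /=; rewrite mulr1. Qed.

(** The trivial multiplier in [twist_sup] turns an almost everywhere bound into a pointwise one. *)
Lemma tp_sup s B x :
  {ae mu, forall y, normc (tp s y) <= B} -> normc (tp s x) <= B.
Proof.
rewrite -(twist1 s) => sB; rewrite -(twist1 (twist _ s)).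
apply: (@twist_sup setT) => //; last by move=> l _; rewrite normr1.
by split=> // l l' _ _; rewrite mulr1.
Qed.

Definition nonneg_tp k (f : R -> R) :=
  (forall x, tp k x = (f x)%:C) /\ (forall x, 0 <= f x).

(** Multiplying by [e^(- i l x)] leaves the modulus equal to [f], whose mean is [coef k 0]. *)
Lemma nonneg_coef k f l : nonneg_tp k f -> normc (coef k l) <=
  complex.Re (coef k 0).
Proof.
move=> [kf f0]; have -> : coef k l = coef (tmul [:: (1, - l)] k) 0.
  rewrite tmul_cons coef_cat coef_mul1 mul1r sub0r opprK.
  by rewrite [X in _ + X]/coef big_nil addr0.
apply: mean_bound; apply/aeW => x.
rewrite tp_mul tp_cons tp_nil addr0 mul1r normcM normc_eix mul1r kf.
by rewrite normcR ger0_norm.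
Qed.

Lemma Re_eq_normc (z : C) : normc z <= complex.Re z -> z = (complex.Re z)%:C.
Proof.
case: z => a b /= ab; congr Complex; apply/eqP.
have a0 : 0 <= a by apply: le_trans ab; exact: sqrtr_ge0.
have : (a ^+ 2 + b ^+ 2) <= a ^+ 2.
  rewrite -[leLHS]sqr_sqrtr ?addr_ge0 ?sqr_ge0//.
  by apply: lerXn2r; rewrite ?nnegrE ?sqrtr_ge0.
rewrite gerDl => b0; rewrite -sqrf_eq0 eq_le b0 sqr_ge0 //.
Qed.

Lemma nonneg_coef0 k f : nonneg_tp k f -> coef k 0 = (complex.Re (coef k 0))%:C.
Proof. by move=> kf; exact/Re_eq_normc/(nonneg_coef 0 kf). Qed.

(** The values of [avg F] lie in [0, 1], and are close to [1] only where all
    [e^(i l x)] with [l] in [F] are close to [1]. *)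
Definition avg (F : seq R) : tpoly R :=
  flatten [seq [:: (((2 * (size F)%:R)^-1)%:C, 0);
                   (((4 * (size F)%:R)^-1)%:C, l);
                   (((4 * (size F)%:R)^-1)%:C, - l)] | l <- F].

Definition avg_val (F : seq R) (x : R) : R :=
  (size F)%:R^-1 * \sum_(l <- F) ((1 + cos (l * x)) / 2).

Lemma tp_avg F x : tp (avg F) x = (avg_val F x)%:C.
Proof.
rewrite /tp /avg big_flatten big_map /avg_val mulr_sumr rmorph_sum /=.
apply: eq_bigr => l _; rewrite !big_cons big_nil addr0.
apply/eqP; rewrite eq_complex !cReD !cImD !cReM !cImM /=.
rewrite mul0r cos0 sin0 mulNr cosN sinN.
set n := (size F)%:R; have -> : (4 * n)^-1 = (2 * n)^-1 / 2 by rewrite -invfM;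
  congr (_^-1); ring.
by rewrite invfM; move: n^-1 => v; apply/andP; split; apply/eqP; field.
Qed.

Lemma avg_val0 F : (0 < size F)%N -> avg_val F 0 = 1.
Proof.
move=> F0; rewrite /avg_val; under eq_bigr => l _ do rewrite mulr0 cos0.
rewrite big_const_seq count_predT iter_addr_0 divff// mulVf//.
by rewrite pnatr_eq0 -lt0n.
Qed.

Lemma avg_val_ge0 F x : 0 <= avg_val F x.
Proof.
rewrite mulr_ge0 ?invr_ge0//; apply: sumr_ge0 => l _.
by have := cos_geN1 (l * x); lra.
Qed.

(** The right-hand side is the sum over [F] of all the [1 - cos], which are nonnegative. *)
Lemma avg_val_cos F l x : l \in F ->
  1 - cos (l * x) <= 2 * (size F)%:R * (1 - avg_val F x).
Proof.
move=> lF; have F0 : (size F)%:R != 0 :> R by case: F lF => // a F _;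
  rewrite pnatr_eq0.
have -> : 2 * (size F)%:R * (1 - avg_val F x) =
    \sum_(l <- F) (1 - cos (l * x)).
  rewrite sumrB big_const_seq count_predT iter_addr_0.
  rewrite /avg_val -mulr_suml big_split /=
    big_const_seq count_predT iter_addr_0.
  by field.
rewrite (big_rem l)//= lerDl; apply: sumr_ge0 => m _.
by rewrite subr_ge0 cos_le1.
Qed.

Lemma nonneg_avg_pow F (N : nat) :
  nonneg_tp (tpow (avg F) N) (fun x => avg_val F x ^+ N).
Proof.
split=> x; last by rewrite exprn_ge0// avg_val_ge0.
by rewrite tp_pow tp_avg rmorphXn.
Qed.

Let U F N := complex.Re (coef (tpow (avg F) N) 0).

(** At the origin the power equals 1; it is there a sum of polynomially many coefficients, each at
    most the mean. So the means decay at most polynomially. *)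
Lemma avg_pow_mean_ge F (N : nat) : (0 < size F)%N ->
  1 <= N.+1%:R ^+ size (avg F) * U F N.
Proof.
move=> F0; have [kf _] := nonneg_avg_pow F N.
have U0 : 0 <= U F N.
  by apply: le_trans (nonneg_coef 0 (nonneg_avg_pow F N)); exact: normc_ge0.
apply: (@le_trans _ _ (normc (tp (tpow (avg F) N) 0))).
  by rewrite kf normcR avg_val0// expr1n normr1.
rewrite /tp (sum_by_freq _ (fun l => eix l 0)).
apply: (le_trans (le_normc_sum _ _ _)).
apply: (@le_trans _ _ (\sum_(l <- undup (freqs (tpow (avg F) N))) U F N)).
  apply: ler_sum => l _; rewrite normcM normc_eix mulr1.
  exact: nonneg_coef (nonneg_avg_pow F N).
rewrite big_const_seq count_predT iter_addr_0 -[leLHS]mulr_natl.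
by apply: ler_wpM2r => //; rewrite -natrX ler_nat size_freqs_pow.
Qed.

Lemma avg_pow_mean_gt0 F (N : nat) : (0 < size F)%N -> 0 < U F N.
Proof.
move=> F0; have := lt_le_trans ltr01 (avg_pow_mean_ge N F0).
by rewrite pmulr_rgt0// exprn_gt0.
Qed.

(** If each step lost a factor [1 - e], the means would decay geometrically, against
    [avg_pow_mean_ge]. *)
Lemma avg_pow_mean_step F e : (0 < size F)%N -> 0 < e < 1 ->
  exists N, (1 - e) * U F N <= U F N.+1.
Proof.
move=> F0 /andP[e0 e1]; apply: contrapT => /forallNP noN.
have U1 N : U F N <= (1 - e) ^+ N.
  elim: N => [|N IH]; first by rewrite /U /coef big_cons eqxx big_nil addr0.
  have /negP := noN N; rewrite -ltNge => /ltW /le_trans; apply.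
  by rewrite exprS ler_wpM2l// subr_ge0 ltW.
have e1' : 0 < 1 - e by rewrite subr_gt0.
have [N] : exists N, N.+1%:R ^+ size (avg F) < (1 - e)^-1 ^+ N.
  by apply: exp_gt_pow; rewrite invf_gt1// ltrBlDr ltrDl.
rewrite exprVn -[ltRHS]mul1r ltr_pdivlMr ?exprn_gt0// ltNge => /negP; apply.
apply: (le_trans (avg_pow_mean_ge N F0)).
by apply: ler_wpM2l => //; exact: exprn_ge0.
Qed.

Lemma normc_eix1_sqr (l x : R) : normc (1 - eix l x) ^+ 2 =
  2 * (1 - cos (l * x)).
Proof.
rewrite normc_sqr !raddfB /= sub0r sqrrN.
by have := cos2Dsin2 (l * x); move: (cos _) (sin _) => c t h; lra.
Qed.

(** The kernel is [avg ^ N] over its mean, with [N] such that one more factor [avg] costs little.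
    The mean of [(1 - avg) k] is then small, and it controls that of [|1 - e^(- i l x)| k], which
    bounds [1 - coef k l]. *)
Lemma exists_kernel (F : seq R) d : 0 < d -> exists k f,
  [/\ nonneg_tp k f, coef k 0 = 1 & forall l, l \in F -> normc (1 - coef k l) <=
    d].
Proof.
move=> d0; wlog F0 : F / (0 < size F)%N.
  move=> hw; have [k [f [h1 h2 h3]]] := hw (0 :: F) isT.
  by exists k, f; split=> // l lF; apply: h3; rewrite inE lF orbT.
wlog d1 : d d0 / d <= 1.
  move=> hw; have [/hw|/ltW d1] := leP d 1; first exact.
  have [k [f [h1 h2 h3]]] := hw 1 ltr01 (lexx _).
  by exists k, f; split=> // l lF; exact: le_trans (h3 l lF) d1.
pose n : R := (size F)%:R; have n0 : 0 < n by rewrite ltr0n.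
have n1 : 1 <= n by rewrite (ler_nat _ 1).
(* Chosen so that the final bound [d / 2 + (2 n / d) e] equals [d]. *)
pose e := d ^+ 2 / (4 * n).
have e0 : 0 < e by rewrite divr_gt0 ?exprn_gt0// mulr_gt0.
have e1 : e < 1.
  rewrite ltr_pdivrMr ?mulr_gt0// mul1r; apply: (@le_lt_trans _ _ 1).
    by rewrite expr_le1// ltW.
  by lra.
have [N hN] := avg_pow_mean_step F0 (introT andP (conj e0 e1)).
have UN := avg_pow_mean_gt0 N F0.
set u := U F N in hN UN.
pose k := tscale (u^-1)%:C (tpow (avg F) N).
have kf : nonneg_tp k (fun x => u^-1 * avg_val F x ^+ N).
  have [h1 h2] := nonneg_avg_pow F N.
  split=> x; first by rewrite tp_scale h1 -rmorphM.
  by rewrite mulr_ge0// invr_ge0 ltW.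
have k1 : coef k 0 = 1.
  rewrite coef_scale (nonneg_coef0 (nonneg_avg_pow F N)) -rmorphM mulVf//.
  by rewrite gt_eqF.
exists k, (fun x => u^-1 * avg_val F x ^+ N); split=> //.
move=> l lF.
pose q := tmul [:: (1, 0); (-1, - l)] k.
have -> : 1 - coef k l = coef q 0.
  rewrite /q !tmul_cons !coef_cat !coef_mul1 subr0 sub0r opprK mul1r mulN1r.
  by rewrite [X in _ + (_ + X)]/coef big_nil addr0 k1.
(* AM-GM on [|1 - e^(ilx)|], whose square is at most [4n (1 - avg)] *)
have ReC (a : R) : complex.Re a%:C = a by [].
have [c0 c0E] : exists c0, c0 = 2 * n / d * u^-1 by eexists.
(* [b] encodes the majorant [(d / 2 + (2 n / d) (1 - avg)) k]. *)
pose b := tscale (d / 2)%:C k ++ tscale c0%:C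
  (tpow (avg F) N ++ tscale (- 1) (tpow (avg F) N.+1)).
apply: (@le_trans _ _ (complex.Re (coef b 0))).
  apply: mean_bound; apply/aeW => x.
  rewrite tp_mul !tp_cons tp_nil !mul1r eix0 addr0 mulN1r normcM.
  have [kx w0] := kf; rewrite kx /b tp_cat tp_scale kx tp_scale tp_cat tp_scale.
  have [-> _] := nonneg_avg_pow F N; have [-> _] := nonneg_avg_pow F N.+1.
  rewrite mulN1r normcR ger0_norm ?w0// -raddfB -!rmorphM -raddfD [leRHS]ReC.
  have := normc_eix1_sqr (- l) x; have := normc_ge0 (1 - eix (- l) x).
  have := avg_val_cos x lF; rewrite mulNr cosN -/n.
  move: (normc _) (avg_val F x) (w0 x) (cos _) => a p wp c ac a0 aa.
  have -> : d / 2 * (u^-1 * p ^+ N) + c0 * (p ^+ N - p ^+ N.+1) =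
      (d / 2 + 2 * n / d * (1 - p)) * (u^-1 * p ^+ N) by rewrite c0E exprS;
        ring.
  apply: ler_wpM2r => //.
  apply: (@le_trans _ _ (d / 2 + a ^+ 2 / (2 * d))).
    rewrite -subr_ge0 (_ : _ - a = (a - d) ^+ 2 / (2 * d)).
      by rewrite divr_ge0 ?sqr_ge0// mulr_ge0// ltW.
    by field; rewrite gt_eqF.
  rewrite lerD2l aa -subr_ge0.
  rewrite (_ : _ - _ = (2 * n * (1 - p) - (1 - c)) / d).
    by apply: divr_ge0; [rewrite subr_ge0|exact: ltW].
  by field; rewrite gt_eqF.
rewrite /b coef_cat !coef_scale coef_cat coef_scale mulN1r.
rewrite (nonneg_coef0 (nonneg_avg_pow F N))
  (nonneg_coef0 (nonneg_avg_pow F N.+1)) -/(U F N) -/(U F N.+1) -/u.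
rewrite -raddfB -!rmorphM -raddfD ReC mulVf ?gt_eqF// mulr1.
have hu : u^-1 * (u - U F N.+1) <= e.
  by rewrite mulrC ler_pdivrMr//; move: hN; rewrite mulrBl mul1r; lra.
rewrite c0E -[_ * u^-1 * _]mulrA;
  apply: (@le_trans _ _ (d / 2 + 2 * n / d * e)).
  by rewrite lerD2l ler_wpM2l// divr_ge0 ?mulr_ge0// ltW.
rewrite le_eqVlt; apply/orP; left; apply/eqP; rewrite /e.
by field; rewrite !gt_eqF.
Qed.

(** The convolution of [k] and [s] with respect to the mean. It is written on the frequencies of
    [k], so that the coefficients of [s] can later be replaced by those of a limit. *)
Definition tconv k s : tpoly R := [seq (a.1 * coef s a.2, a.2) | a <- k].

(** The value at [x] is the mean over [t] of [k t * s (x - t)], an average of values of [s] with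
    weights of mean 1. The list [r] encodes [s (x - t)] as a sum in [t]. *)
Lemma tconv_sup k f s B x : nonneg_tp k f -> coef k 0 = 1 ->
  (forall y, normc (tp s y) <= B) -> normc (tp (tconv k s) x) <= B.
Proof.
move=> [kf f0] k1 sB.
pose r : tpoly R := [seq (a.1 * eix a.2 x, - a.2) | a <- s].
have tr t : tp r t = tp s (x - t).
  by rewrite /tp big_map; apply: eq_bigr => a _; rewrite eix_sub mulrA.
have cr l : coef r (- l) = coef s l * eix l x.
  rewrite /coef big_map mulr_suml; apply: eq_big => a; rewrite eqr_opp //.
  by move=> /eqP ->.
have -> : tp (tconv k s) x = coef (tmul k r) 0.
  rewrite /tp /tconv big_map; elim: k {kf k1} => [|a k IH].
    by rewrite /coef !big_nil.
  by rewrite big_cons IH tmul_cons coef_cat coef_mul1 sub0r cr mulrA.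
have -> : B =
  complex.Re (coef (tscale B%:C k) 0) by rewrite coef_scale k1 mulr1.
apply: mean_bound; apply/aeW => t.
rewrite tp_mul tp_scale kf -rmorphM normcM normcR ger0_norm// tr mulrC /=.
by rewrite ler_wpM2r.
Qed.

Lemma tconv_sym k s x :
  tp (tconv k s) x = \sum_(b <- s) b.1 * coef k b.2 * eix b.2 x.
Proof.
rewrite /tp /tconv big_map.
transitivity (\sum_(a <- k) \sum_(b <- s | b.2 == a.2) a.1 * b.1 * eix a.2 x).
  by apply: eq_bigr => a _; rewrite /coef mulr_sumr mulr_suml.
rewrite (exchange_big_dep predT)//=; apply: eq_bigr => b _.
rewrite /coef mulr_sumr mulr_suml; apply: eq_big => [a|a /eqP ->].
  by rewrite eq_sym.
by rewrite [a.1 * _]mulrC.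
Qed.

(** Convolution multiplies each coefficient of [s] by one of the kernel, and these are close to 1 on
    the finitely many frequencies of [s]. *)
Lemma exists_approx_tconv s e : 0 < e -> exists k f,
  [/\ nonneg_tp k f, coef k 0 = 1 &
      forall x, normc (tp s x - tp (tconv k s) x) <= e].
Proof.
move=> e0; pose M := \sum_(b <- s) normc b.1.
have M0 : 0 <= M by apply: sumr_ge0 => b _; exact: normc_ge0.
have d0 : 0 < e / (M + 1) by rewrite divr_gt0// ltr_wpDl.
have [k [f [kf k1 kl]]] := exists_kernel (freqs s) d0.
exists k, f; split=> // x.
rewrite tconv_sym /tp -sumrB; apply: (le_trans (le_normc_sum _ _ _)).
apply: (@le_trans _ _ (\sum_(b <- s) normc b.1 * (e / (M + 1)))).
  rewrite big_seq [leRHS]big_seq; apply: ler_sum => b bs.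
  rewrite -mulrA -mulrBr -[X in _ * (X - _)]mul1r -mulrBl mulrA !normcM
    normc_eix mulr1.
  rewrite -[leRHS]mulrA; apply: ler_wpM2l;
    [exact: normc_ge0|apply: kl; exact: map_f].
rewrite -mulr_suml -/M mulrA ler_pdivrMr ?ltr_wpDl//.
by rewrite mulrC ler_wpM2l ?ltW// ltrDl.
Qed.

End Kernel.

(** * Classes of bounded functions *)

Section LinfRepresentatives.
Variable R : realType.
Local Notation C := R[i].
Local Notation mu := (@lebesgue_measure R).
Implicit Types (F G : Linf R) (u v : LinfFun R) (B e : R).

Lemma to_Linf_repr F : to_Linf (Linf_repr F) = F.
Proof. exact: reprK. Qed.

Lemma to_LinfP u v : to_Linf u = to_Linf v <-> {ae mu, forall x, u x = v x}.
Proof.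
have aeF := ae_filter_ringOfSetsType mu.
have -> : (to_Linf u = to_Linf v) <-> (u - v \in @ae_null R).
  rewrite Quotient.idealrBE; split=> [h|/eqP//]; exact/eqP.
split=> [/asboolP h|h]; last apply/asboolP.
  by apply: filterS h => x /(@eqP _ (u x - v x)); rewrite subr_eq0 => /eqP.
by apply: filterS h => x uv; change (u x - v x = 0); rewrite uv subrr.
Qed.

Lemma to_LinfD u v : to_Linf (u + v) = to_Linf u + to_Linf v.
Proof. exact: rmorphD. Qed.

Lemma to_LinfN u : to_Linf (- u) = - to_Linf u.
Proof. exact: rmorphN. Qed.

Lemma to_LinfM u v : to_Linf (u * v) = to_Linf u * to_Linf v.
Proof. exact: rmorphM. Qed.

Lemma to_Linf1 : to_Linf 1 = 1 :> Linf R.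
Proof. exact: rmorph1. Qed.

Lemma repr_to_Linf u : {ae mu, forall x, Linf_repr (to_Linf u) x = u x}.
Proof. by apply/to_LinfP; rewrite to_Linf_repr. Qed.

(** It names a class by an explicit function, equal everywhere to a representative, so that
    identities and bounds in [Linf] reduce to pointwise ones. *)
Definition class_of F (f : R -> C) := exists2 u, F = to_Linf u & forall x, u x =
  f x.

Lemma class_of_repr F : class_of F (Linf_repr F).
Proof. by exists (Linf_repr F) => //; rewrite to_Linf_repr. Qed.

Lemma class_ofD F G f g : class_of F f -> class_of G g ->
  class_of (F + G) (fun x => f x + g x).
Proof.
move=> [u -> uf] [v -> vg]; exists (u + v); first by rewrite to_LinfD.
by move=> x; rewrite -uf -vg.
Qed.

Lemma class_ofN F f : class_of F f -> class_of (- F) (fun x => - f x).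
Proof.
move=> [u -> uf]; exists (- u); first by rewrite to_LinfN.
by move=> x; rewrite -uf.
Qed.

Lemma class_ofM F G f g : class_of F f -> class_of G g ->
  class_of (F * G) (fun x => f x * g x).
Proof.
move=> [u -> uf] [v -> vg]; exists (u * v); first by rewrite to_LinfM.
by move=> x; rewrite -uf -vg.
Qed.

Lemma class_of_cst (c : C) : class_of (Linf_cst c) (fun=> c).
Proof. by eexists. Qed.

Lemma class_of_expi (l : R) : class_of (expi l) (eix l).
Proof. by eexists. Qed.

Lemma class_of1 : class_of 1 (fun=> 1).
Proof. by exists 1; rewrite ?to_Linf1. Qed.

Lemma class_of0 : class_of 0 (fun=> 0).
Proof. by exists 0 => //; apply/esym; exact: rmorph0. Qed.

Lemma class_of_ae F f : class_of F f -> {ae mu, forall x, Linf_repr F x = f x}.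
Proof.
have aeF := ae_filter_ringOfSetsType mu.
by move=> [u -> uf]; have := repr_to_Linf u; apply: filterS => x ->.
Qed.

Lemma class_of_inj F G f g : class_of F f -> class_of G g ->
  (forall x, f x = g x) -> F = G.
Proof.
move=> [u -> uf] [v -> vg] fg; apply/to_LinfP; apply/aeW => x.
by rewrite uf vg.
Qed.

Definition Linf_le F B := {ae mu, forall x, normc (Linf_repr F x) <= B}.

Lemma Linf_leP F f B : class_of F f -> Linf_le F B <->
  {ae mu, forall x, normc (f x) <= B}.
Proof.
have aeF := ae_filter_ringOfSetsType mu.
by move=> /class_of_ae Ff; split; apply: filterS2 Ff => x ->.
Qed.

Lemma Linf_le_norm F B : Linf_le F B <-> (Linf_norm F <= B%:E)%E.
Proof.
have aeF := ae_filter_ringOfSetsType mu.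
split=> [h|/ess_supP h]; first apply/ess_supP.
  by apply: filterS h => x; rewrite lee_fin.
by apply: filterS h => x; rewrite lee_fin.
Qed.

Lemma Linf_le_ge0 F B : Linf_le F B -> 0 <= B.
Proof.
have aeF := ae_filter_ringOfSetsType mu.
move=> FB; rewrite leNgt; apply/negP => B0.
have [N [mN N0 sN]] : {ae mu, forall x : R, False}.
  apply: filterS FB => x /le_lt_trans /(_ B0).
  by rewrite ltNge normc_ge0.
have NT : N = setT by apply/seteqP; split=> // x _; apply: sN.
by move: N0; rewrite NT -set_itvNyy lebesgue_measure_itv.
Qed.

Lemma Linf_le_trans F B B' : B <= B' -> Linf_le F B -> Linf_le F B'.
Proof.
have aeF := ae_filter_ringOfSetsType mu.
by move=> BB; apply: filterS => x /le_trans; apply.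
Qed.

Lemma Linf_leD F G B B' : Linf_le F B -> Linf_le G B' ->
  Linf_le (F + G) (B + B').
Proof.
have aeF := ae_filter_ringOfSetsType mu.
move=> FB GB.
apply/(Linf_leP _ (class_ofD (class_of_repr F) (class_of_repr G))).
apply: filterS2 FB GB => x FB GB.
by apply: (le_trans (le_normcD _ _)); exact: lerD.
Qed.

Lemma Linf_leN F B : Linf_le F B -> Linf_le (- F) B.
Proof.
have aeF := ae_filter_ringOfSetsType mu.
move=> FB; apply/(Linf_leP _ (class_ofN (class_of_repr F))).
by apply: filterS FB => x; rewrite normcN.
Qed.

Lemma Linf_leB F G B B' : Linf_le F B -> Linf_le G B' ->
  Linf_le (F - G) (B + B').
Proof. by move=> FB /Linf_leN; exact: Linf_leD. Qed.

Lemma Linf_le_distC F G B : Linf_le (F - G) B -> Linf_le (G - F) B.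
Proof. by move=> /Linf_leN; rewrite opprB. Qed.

Lemma Linf_leM F G B B' : Linf_le F B -> Linf_le G B' ->
  Linf_le (F * G) (B * B').
Proof.
have aeF := ae_filter_ringOfSetsType mu.
move=> FB GB;
  apply/(Linf_leP _ (class_ofM (class_of_repr F) (class_of_repr G))).
apply: filterS2 FB GB => x FB GB.
by rewrite normcM; apply: ler_pM => //; exact: normc_ge0.
Qed.

Lemma Linf_le0 : Linf_le 0 0.
Proof. by apply/(Linf_leP _ class_of0); apply/aeW => x; rewrite normc0. Qed.

Lemma Linf_le1 : Linf_le 1 1.
Proof. by apply/(Linf_leP _ class_of1); apply/aeW => x; rewrite normc1. Qed.

Lemma Linf_leX F B k : Linf_le F B -> Linf_le (F ^+ k) (B ^+ k).
Proof.
by move=> FB; elim: k => [|k IH];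
  [exact: Linf_le1|rewrite !exprS; exact: Linf_leM].
Qed.

Lemma Linf_le_exists F : exists B, Linf_le F B.
Proof.
have : (Linf_norm F < +oo)%E.
  by have /asboolP[_ _] := valP (Linf_repr F).
by move=> /essnorm_ltoo[M hM]; exists M.
Qed.

Lemma Linf_cstB c d : Linf_cst (c - d) = Linf_cst c - Linf_cst d :> Linf R.
Proof.
apply: (class_of_inj (class_of_cst _)
  (class_ofD (class_of_cst c) (class_ofN (class_of_cst d)))).
by [].
Qed.

Lemma Linf_cstM c d : Linf_cst (c * d) = Linf_cst c * Linf_cst d :> Linf R.
Proof. exact: (class_of_inj (class_of_cst _)
  (class_ofM (class_of_cst c) (class_of_cst d))). Qed.

Lemma Linf_cst1 : Linf_cst 1 = 1 :> Linf R.
Proof. exact: (class_of_inj (class_of_cst _) class_of1). Qed.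

Definition tpL (s : tpoly R) : Linf R := \sum_(t <- s) Linf_cst t.1 * expi t.2.

Lemma class_of_tpL s : class_of (tpL s) (tp s).
Proof.
elim: s => [|t s IH].
  have -> : tp [::] = (fun=> 0 : C) by apply/funext => x; rewrite tp_nil.
  by rewrite /tpL big_nil; exact: class_of0.
have -> : tp (t :: s) = (fun x => t.1 * eix t.2 x + tp s x).
  by apply/funext => x; rewrite tp_cons.
rewrite /tpL big_cons; apply: class_ofD => //.
by apply: class_ofM; [exact: class_of_cst|exact: class_of_expi].
Qed.

Lemma Linf_le_tpL s B : Linf_le (tpL s) B <-> forall x, normc (tp s x) <= B.
Proof.
split=> [/(Linf_leP _ (class_of_tpL s)) h x|h]; first exact: tp_sup.
by apply/(Linf_leP _ (class_of_tpL s)); apply/aeW.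
Qed.

Lemma tpL_cat s s' : tpL (s ++ s') = tpL s + tpL s'.
Proof. by rewrite /tpL big_cat. Qed.

Lemma tpLN s : tpL (tscale (-1) s) = - tpL s.
Proof.
apply: (class_of_inj (class_of_tpL _) (class_ofN (class_of_tpL s))).
by move=> x; rewrite tp_scale mulN1r.
Qed.

Lemma tpL_mul s s' : tpL (tmul s s') = tpL s * tpL s'.
Proof.
apply: (class_of_inj (class_of_tpL _)
  (class_ofM (class_of_tpL s) (class_of_tpL s'))).
by move=> x; rewrite tp_mul.
Qed.

Lemma tpL_cst c : tpL [:: (c, 0)] = Linf_cst c.
Proof.
apply: (class_of_inj (class_of_tpL _) (class_of_cst c)).
by move=> x; rewrite tp_cons tp_nil addr0 eix0 mulr1.
Qed.

(** The inverse is taken pointwise, so completeness of [L^oo] is not needed. *)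
Lemma Linf_inv_near1 F : Linf_le (F - 1) (1 / 2) -> exists2 G, F * G =
  1 & Linf_le G 2.
Proof.
have aeF := ae_filter_ringOfSetsType mu.
move=> F1; pose u := Linf_repr F.
have F1' : {ae mu, forall x, normc (u x - 1) <= 1 / 2}.
  exact/(Linf_leP _ (class_ofD (class_of_repr F) (class_ofN class_of1))).
have u2 : {ae mu, forall x, 1 / 2 <= normc (u x)}.
  apply: filterS F1' => x h.
  have : normc (1 - (1 - u x) : C) <= normc (u x) by rewrite subKr.
  have := le_normcD (u x) (1 - u x); rewrite addrC subrK normc1.
  by rewrite -normcN opprB in h; lra.
(* The squared modulus is at least 1/4 almost everywhere. Taking the maximum with 1/4 makes [w] a
   continuous function of it, hence measurable, and changes nothing where that bound holds. *)
pose w x := (Num.max (complex.Re (u x) ^+ 2 + complex.Im (u x) ^+ 2)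
  (1 / 4))^-1.
have /linf_funP[mRe mIm _] := valP u.
have mw : measurable_fun setT w.
  pose i4 (t : R) := (Num.max t (1 / 4))^-1.
  have ci4 : continuous i4.
    have cf : continuous (fun t : R => Num.max t (1 / 4)).
      by move=> t; apply: (@continuous_max _ _ id (cst (1 / 4)));
        [exact: cvg_id|exact: cvg_cst].
    move=> t; apply: (@continuousV _ _ (fun t : R => Num.max t (1 / 4)));
      last exact: cf.
    by rewrite gt_eqF// lt_max; apply/orP; right; lra.
  apply: (measurableT_comp (continuous_measurable_fun ci4)).
  by apply: measurable_funD; exact: measurable_funX.
pose v x : C := (complex.Re (u x) * w x) -i* (complex.Im (u x) * w x).
have uv : {ae mu, forall x, u x * v x = 1}.
  apply: filterS u2 => x h.
  have h2 : 1 / 4 <= complex.Re (u x) ^+ 2 + complex.Im (u x) ^+ 2.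
    rewrite -normc_sqr (_ : 1 / 4 = (1 / 2) ^+ 2); last by field.
    by apply: lerXn2r => //; rewrite nnegrE ?normc_ge0//; lra.
  apply/eqP; rewrite eq_complex cReM cImM /v /w (max_idPl h2) /=.
  move: h2; move: (complex.Re _) (complex.Im _) => a b ab.
  have ab0 : a ^+ 2 + b ^+ 2 != 0 by rewrite gt_eqF//; lra.
  by apply/andP; split; apply/eqP; field.
have v2 : {ae mu, forall x, normc (v x) <= 2}.
  apply: filterS2 u2 uv => x ux uv.
  have := congr1 (@normc R) uv; rewrite normcM normc1.
  have := normc_ge0 (v x); move: (normc _) (normc _) ux => a b; nra.
have lv : v \in @linf_fun R.
  apply/linf_funP; split.
  - exact: measurable_funM.
  - by apply: measurableT_comp => //; exact: measurable_funM.
  - by exists 2.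
have cv : class_of (to_Linf (MkLinfFun lv)) v by eexists.
exists (to_Linf (MkLinfFun lv)); last by apply/(Linf_leP _ cv).
rewrite -{1}(to_Linf_repr F) -to_LinfM -to_Linf1; apply/to_LinfP.
exact: uv.
Qed.

End LinfRepresentatives.

(** * Bohr coefficients *)

Section BohrCoefficients.
Variable R : realType.
Local Notation C := R[i].
Local Notation mu := (@lebesgue_measure R).
Implicit Types (F G : Linf R) (s : tpoly R).

Lemma cvg_to_complex (T : Type) (FF : set_system T) (fF : Filter FF)
  (f : T -> C) (c : C) :
  (forall e : R, 0 < e -> \forall t \near FF, normc (f t - c) <= e) ->
  (f t : C^o) @[t --> FF] --> (c : C^o).
Proof.
move=> h; apply/cvgrPdist_le => e e0.
(* In the order on [C], a positive [e] is real. *)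
have eE : e = (complex.Re e)%:C by rewrite RRe_real// ger0_real// ltW.
rewrite eE; rewrite eE ltcR in e0.
apply: filterS (h _ e0) => t; rewrite -normcN opprB => h'.
by rewrite normc_def lecR; move: h'; case: (c - f t).
Qed.

Lemma Rintegral_ae_Re (f : R -> R) s (r : R) : measurable_fun setT f ->
  {ae mu, forall x, f x = complex.Re (tp s x)} ->
  (\int[mu]_(x in `[- r, r]) f x =
    \int[mu]_(x in `[- r, r]) complex.Re (tp s x))%R.
Proof.
have aeF := ae_filter_ringOfSetsType mu.
move=> mf fs; congr fine; apply: ae_eq_integral => //.
- by apply/measurable_EFinP; apply: measurable_funTS.
- apply/measurable_EFinP; apply: measurable_funTS.
  apply: continuous_measurable_fun; exact: continuous_Re_tp.
- by apply: filterS fs => x fx _ /=; rewrite fx.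
Qed.

Lemma inner_tpL s (l : R) : inner (tpL s) (expi l) = coef s l.
Proof.
have aeF := ae_filter_ringOfSetsType mu.
(* The real part of [s2] is the imaginary part of [s1], so both components of the integral are
   integrals of real parts. *)
pose s1 := tmul [:: (1, - l)] s; pose s2 := tscale (- 'i) s1.
have c1 : coef s1 0 = coef s l.
  rewrite /s1 tmul_cons coef_cat coef_mul1 mul1r sub0r opprK.
  by rewrite [X in _ + X]/coef big_nil addr0.
have ReNi (z : C) : complex.Re (- 'i * z) = complex.Im z.
  by rewrite cReM /= oppr0 mul0r sub0r mulN1r opprK.
have [K1 K10 h1] := tprim_bound s1; have [K2 K20 h2] := tprim_bound s2.
have /linf_funP[mR1 mI1 _] := valP (Linf_repr (tpL s)).
have /linf_funP[mR2 mI2 _] := valP (Linf_repr (expi l)).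
pose g x := Linf_repr (tpL s) x * (Linf_repr (expi l) x)^*.
have gs : {ae mu, forall x, g x = tp s1 x}.
  have := class_of_ae (class_of_tpL s); have := class_of_ae (class_of_expi l).
  apply: filterS2 => x; rewrite /g => -> ->.
  rewrite tp_mul tp_cons tp_nil addr0 mul1r mulrC; congr (_ * _).
  by rewrite /eix mulNr cosN sinN.
have mRe : measurable_fun setT (fun x => complex.Re (g x)).
  rewrite (_ : (fun x => _) = (fun x => complex.Re (Linf_repr (tpL s) x)) \*
     (fun x => complex.Re (Linf_repr (expi l) x)) \+
    (fun x => complex.Im (Linf_repr (tpL s) x)) \*
     (fun x => complex.Im (Linf_repr (expi l) x))).
    by apply: measurable_funD; exact: measurable_funM.
  apply/funext => x; rewrite /g cReM /=; case: (Linf_repr (expi l) x) => a b /=.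
  by rewrite mulrN opprK.
have mIm : measurable_fun setT (fun x => complex.Im (g x)).
  rewrite (_ : (fun x => _) = (fun x => complex.Im (Linf_repr (tpL s) x)) \*
     (fun x => complex.Re (Linf_repr (expi l) x)) \-
    (fun x => complex.Re (Linf_repr (tpL s) x)) \*
     (fun x => complex.Im (Linf_repr (expi l) x))).
    by apply: measurable_funB; exact: measurable_funM.
  apply/funext => x; rewrite /g cImM /=; case: (Linf_repr (expi l) x) => a b /=.
  by rewrite mulrN addrC.
rewrite /inner; apply: (@cvg_lim (C^o : pseudoMetricNormedZmodType C));
  first exact: norm_hausdorff.
apply: cvg_to_complex => e e0.
near=> r.
have r0 : 0 < r by near: r; apply: nbhs_pinfty_gt; exact: num_real.
(* The two integrals have errors at most [K1] and [K2]; divided by [2 r] these add up to at most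
   [e]. *)
have rK : (K1 + K2) / (2 * e) <= r by near: r; apply: nbhs_pinfty_ge;
  exact: num_real.
rewrite /cintegral (Rintegral_ae_Re (s := s1) r mRe);
  last by apply: filterS gs => x ->.
rewrite (Rintegral_ae_Re (s := s2) r mIm); last first.
  by apply: filterS gs => x ->; rewrite tp_scale ReNi.
rewrite !Rintegral_tp//; have := h1 r; have := h2 r.
rewrite coef_scale ReNi -c1.
move: (coef s1 0) (tprim s1 r - _) (tprim s2 r - _) => z u v hv hu.
apply: (le_trans (normc_le_ReIm _)); rewrite cReB cImB cReM cImM.
case: z hv hu => a b /= hv hu; rewrite !mul0r subr0 addr0.
have -> : (2 * r)^-1 * u - a = (2 * r)^-1 * (u - r * 2 * a) by field;
  rewrite gt_eqF.
have -> : (2 * r)^-1 * v - b = (2 * r)^-1 * (v - r * 2 * b) by field;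
  rewrite gt_eqF.
rewrite !normrM -mulrDr ger0_norm; last by rewrite invr_ge0 mulr_ge0 // ltW.
rewrite ler_pdivrMl ?mulr_gt0//; apply: (le_trans (lerD hu hv)).
by move: rK; rewrite ler_pdivrMr ?mulr_gt0// mulrA [_ * 2]mulrC.
Unshelve. all: by end_near. Qed.

Lemma Linf_norm_ge0 F : (0 <= Linf_norm F)%E.
Proof.
have muT : (0 < mu setT)%E by rewrite -set_itvNyy lebesgue_measure_itv /=;
  exact: ltry.
apply: ess_sup_gee => //.
by apply/aeW => x; rewrite lee_fin normc_ge0.
Qed.

Lemma AP_approx F : AP F <-> forall e : R, 0 < e -> exists s,
  Linf_le (F - tpL s) e.
Proof.
split=> h e e0.
  by have [_ [s ->] /ltW/Linf_le_norm sF] := h e e0; exists s.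
have [|s /Linf_le_norm sF] := h (e / 2); first by rewrite divr_gt0.
exists (tpL s); first by exists s.
by apply: (le_lt_trans sF); rewrite lte_fin ltr_pdivrMr// ltr_pMr// ltr1n.
Qed.

Lemma coef_dist F s s' l e e' : Linf_le (F - tpL s) e ->
  Linf_le (F - tpL s') e' ->
  normc (coef s l - coef s' l) <= e + e'.
Proof.
move=> h h'; have := Linf_leB h' h;
  rewrite opprB addrC addrA subrK -tpLN -tpL_cat => ss'.
have -> : coef s l - coef s' l = coef (s ++ tscale (-1) s') l.
  by rewrite coef_cat coef_scale mulN1r.
rewrite addrC; apply: coef_bound; exact/(Linf_leP _ (class_of_tpL _)).
Qed.

(** Helly's theorem on the line: among pairwise intersecting intervals [[v - e, v + e]], the
    supremum of the left ends is a common point. It yields the limit coefficient together with its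
    error bound. *)
Lemma interval_helly (P : R -> R -> Prop) : (exists v e, P v e) ->
  (forall v e v' e', P v e -> P v' e' -> v - v' <= e + e') ->
  exists a, forall v e, P v e -> `|v - a| <= e.
Proof.
move=> [v0 [e0 P0]] PP; pose E := [set x | exists v e, P v e /\ x = v - e].
have E0 : E !=set0 by exists (v0 - e0), v0, e0.
have Eub v e : P v e -> ubound E (v + e).
  by move=> Pv _ [v' [e' [Pv' ->]]]; have := PP _ _ _ _ Pv' Pv; lra.
have supE : has_sup E by split=> //; exists (v0 + e0); exact: Eub.
exists (sup E) => v e Pv.
have h1 : sup E <= v + e by apply: ge_sup => //; exact: Eub.
have h2 : v - e <= sup E by apply: ub_le_sup; [case: supE|exists v, e].
by rewrite ler_norml; apply/andP; split; lra.
Qed.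

(** Two approximations of [F] have close coefficients, so Helly applies to real and imaginary parts
    separately; hence the factor 2. *)
Lemma coef_limit F l : AP F -> exists c, forall s e, Linf_le (F - tpL s) e ->
  normc (coef s l - c) <= 2 * e.
Proof.
move=> /AP_approx apF.
have lim (p : C -> R) : (forall z, p z <= normc z) -> {morph p : x y / x - y} ->
    exists a, forall s e, Linf_le (F - tpL s) e -> `|p (coef s l) - a| <= e.
  move=> pn pB.
  have [||a ha] :=
    @interval_helly
    (fun v e => exists2 s, Linf_le (F - tpL s) e & v = p (coef s l)).
  - by have [s sF] := apF 1 ltr01; exists (p (coef s l)), 1, s.
  - move=> v e v' e' [s sF ->] [s' s'F ->]; rewrite -pB.
    by apply: le_trans (pn _) _; exact: coef_dist sF s'F.
  - by exists a => s e sF; apply: ha; exists s.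
have [a ha] := lim (@complex.Re R) (@Re_le_normc R) (@cReB R).
have [b hb] := lim (@complex.Im R) (@Im_le_normc R) (@cImB R).
exists (a +i* b) => s e sF; apply: (le_trans (normc_le_ReIm _)).
rewrite !raddfB /= mulrDl mul1r; apply: lerD; [exact: ha|exact: hb].
Qed.

Lemma bohr_coefE F l c : AP F ->
  (forall s e, Linf_le (F - tpL s) e -> normc (coef s l - c) <= 2 * e) ->
  bohr_coef F l = c.
Proof.
move=> /AP_approx apF hc.
have cP (p : nat -> Linf R) : (forall n, trigpoly (p n)) ->
    Linf_norm (p n - F) @[n --> \oo] --> 0%E ->
    (inner (p n) (expi l) : C^o) @[n --> \oo] --> (c : C^o).
  move=> pT /fine_cvgP[pfin pF].
  apply: cvg_to_complex => e e0.
  have e20 : 0 < e / 2 by rewrite divr_gt0.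
  move/cvgrPdist_le : pF => /(_ _ e20); apply: filterS2 pfin => n fin hn.
  have [s ps] := pT n; rewrite -/(tpL s) in ps; rewrite ps inner_tpL.
  rewrite (_ : e = 2 * (e / 2)); last by field.
  apply: hc; apply: Linf_le_distC; rewrite -ps; apply/Linf_le_norm.
  rewrite -(fineK fin) lee_fin; apply: le_trans hn.
  by rewrite sub0r normrN ler_norm.
apply: xget_unique => // d hd.
(* Uniqueness: along sums within [1 / (n + 1)] of [F], the coefficients tend both to [c] and to any
   other candidate [d]. *)
have /choice[t ht] : forall n : nat, exists s, Linf_le (F - tpL s) n.+1%:R^-1.
  by move=> n; apply: apF; rewrite invr_gt0.
have tT n : trigpoly (tpL (t n)) by exists (t n).
have tF : Linf_norm (tpL (t n) - F) @[n --> \oo] --> 0%E.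
  apply: (@squeeze_cvge _ _ _ _ (fun=> 0%E) _ (fun n => (n.+1%:R^-1)%:E)).
  - near=> n; apply/andP; split; last by apply/Linf_le_norm/Linf_le_distC/ht.
    exact: Linf_norm_ge0.
  - exact: cvg_cst.
  - by apply/fine_cvgP; split; [exact: nearW|exact: cvg_harmonic].
have h1 := cP _ tT tF; have h2 := hd _ tT tF.
exact: (cvg_unique _ h2 h1).
Unshelve. all: by end_near. Qed.

End BohrCoefficients.

(** * Rearrangements of differences and the geometric sum *)

Section RingIdentities.
Variable A : comNzRingType.
Implicit Types x y z t : A.

Lemma sub_trans y x z : x - z = (x - y) + (y - z).
Proof. by ring. Qed.

Lemma sub_trans3 y z t x w : x - w = (x - y) + (y - z) + (z - t) + (t - w).
Proof. by ring. Qed.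

Lemma sub_sub x y z t : x - y - (z - t) = (x - z) - (y - t).
Proof. by ring. Qed.

Lemma sub_mul x y z t : x * y - z * t = (x - z) * y + (x - (x - z)) * (y - t).
Proof. by ring. Qed.

Lemma sub_geometric x y (N : nat) :
  x * y = 1 -> y - \sum_(i < N) (1 - x) ^+ i = y * (1 - x) ^+ N.
Proof.
move=> xy; have := subrX1 (1 - x) N; set X := (1 - x) ^+ N; set Y :=
  \sum_(_ < _) _.
move=> /(canRL (subrK _)) ->.
have -> : y * ((1 - x - 1) * Y + 1) = y - (x * y) * Y by ring.
by rewrite xy mul1r.
Qed.

End RingIdentities.

(** * AP+ as a closed subring: limits of sums with nonnegative frequencies *)

Section APplusTheory.
Variable R : realType.
Local Notation C := R[i].
Implicit Types (F G : Linf R) (s : tpoly R) (e : R).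

Definition nonneg_freq : set R := [set l | 0 <= l].

(** [F] is close to a sum [s], hence to [tconv k s], to [tconv k s'] for a better approximation
    [s'], and finally to [g], the convolution of the kernel with [F] itself. The coefficients of [g]
    contain Bohr coefficients of [F] as factors, so they vanish at negative frequencies. *)
Lemma AP_sub_APplus F : AP F -> bohr_spectrum F `<=` `[0, +oo[ ->
  forall e, 0 < e -> exists2 s, tpoly_on nonneg_freq s & Linf_le (F - tpL s) e.
Proof.
move=> apF spF e e0.
have /choice[c hc] : forall l, exists c, forall s e, Linf_le (F - tpL s) e ->
  normc (coef s l - c) <= 2 * e by move=> l; exact: coef_limit.
have c0 l : l < 0 -> c l = 0.
  move=> l0; rewrite -(bohr_coefE apF (hc l)); apply/eqP/negPn/negP => h.
  by have := spF _ h; rewrite /= in_itv /= andbT leNgt l0.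
have /AP_approx apF' := apF.
have e8 : 0 < e / 8 by rewrite divr_gt0.
have [s sF] := apF' _ e8.
have [k [f [kf k1 ks]]] := exists_approx_tconv s e8.
pose K := \sum_(a <- k) normc a.1.
have K0 : 0 <= K by apply: sumr_ge0 => a _; exact: normc_ge0.
(* The kernel is fixed before [s'], so [d] may depend on [K]. Replacing the coefficients of [s'] by
   those of [F] costs at most [2 d K]. *)
pose d := e / 8 / (2 * K + 1).
have K1 : 0 < 2 * K + 1 by rewrite ltr_wpDl// mulr_ge0.
have d0 : 0 < d by rewrite divr_gt0.
have dE : d * (2 * K + 1) = e / 8 by rewrite divfK// gt_eqF.
have dK : 0 <= d * K by rewrite mulr_ge0// ltW.
have [s' s'F] := apF' _ d0.
pose g : tpoly R := [seq (a.1 * c a.2, a.2) | a <- k].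
exists [seq a <- g | 0 <= a.2].
  by move=> t; rewrite mem_filter => /andP[].
have -> : tpL [seq a <- g | 0 <= a.2] = tpL g.
  apply: (class_of_inj (class_of_tpL _) (class_of_tpL _)) => x.
  rewrite /tp big_filter big_mkcond /= !big_map; apply: eq_bigr => a _ /=.
  by case: leP => // /c0 ->; rewrite mulr0 mul0r.
rewrite (sub_trans3 (tpL s) (tpL (tconv k s)) (tpL (tconv k s'))).
apply: (@Linf_le_trans _ _ (e / 8 + e / 8 + (d + e / 8) + 2 * d * K));
  first by lra.
apply: Linf_leD; [apply: Linf_leD; [apply: Linf_leD => //|]|].
- by apply/(Linf_leP _
  (class_ofD (class_of_tpL _) (class_ofN (class_of_tpL _)))); apply/aeW.
- have ss' : forall x, normc (tp (s ++ tscale (-1) s') x) <= d + e / 8.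
    apply/Linf_le_tpL; rewrite tpL_cat tpLN.
    by have := Linf_leB s'F sF; rewrite opprB addrC addrA subrK.
  apply/(Linf_leP _ (class_ofD (class_of_tpL _) (class_ofN (class_of_tpL _))));
    apply/aeW => x.
  have := tconv_sup x kf k1 ss'; congr (normc _ <= _).
  rewrite !tconv_sym; rewrite big_cat big_map /= -sumrN; congr (_ + _).
  by apply: eq_bigr => b _; rewrite mulN1r !mulNr.
- apply/(Linf_leP _ (class_ofD (class_of_tpL _) (class_ofN (class_of_tpL _))));
  apply/aeW => x.
  rewrite /tp !big_map -sumrB; apply: (le_trans (le_normc_sum _ _ _)).
  rewrite /K mulr_sumr; apply: ler_sum => a _ /=.
  rewrite -mulrBl -mulrBr !normcM normc_eix mulr1 mulrC.
  by apply: ler_wpM2r; [exact: normc_ge0|exact: hc].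
Qed.

Lemma APplusP F : APplus F <->
  forall e, 0 < e -> exists2 s, tpoly_on nonneg_freq s & Linf_le (F - tpL s) e.
Proof.
split=> [[apF spF]|h]; first exact: AP_sub_APplus.
have apF : AP F by apply/AP_approx => e /h[s _ sF]; exists s.
split=> // l; rewrite /= in_itv /= andbT => lF; rewrite leNgt; apply/negP => l0.
have [c hc] := coef_limit l apF.
suff c0 : c = 0 by move/negP: lF; apply; rewrite (bohr_coefE apF hc) c0.
apply: eq0_normc; apply/eqP; rewrite eq_le normc_ge0 andbT.
apply/ler_addgt0Pl => e e0; rewrite addr0.
have e20 : 0 < e / 2 by rewrite divr_gt0.
have [s s0 sF] := h _ e20.
have := hc _ _ sF; rewrite /coef big1_seq ?sub0r ?normcN.
  by rewrite mulrC divfK.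
by move=> t /andP[/eqP tl /s0]; rewrite /nonneg_freq /= tl leNgt l0.
Qed.

Lemma APplus_tpL s : tpoly_on nonneg_freq s -> APplus (tpL s).
Proof.
move=> s0; apply/APplusP => e e0; exists s => //.
by rewrite subrr; apply: Linf_le_trans (Linf_le0 R); exact: ltW.
Qed.

Lemma APplus_closed F :
  (forall e, 0 < e -> exists2 G, APplus G & Linf_le (F - G) e) -> APplus F.
Proof.
move=> h; apply/APplusP => e e0; have e20 : 0 < e / 2 by rewrite divr_gt0.
have [G /APplusP/(_ _ e20)[s s0 sG] FG] := h _ e20; exists s => //.
by rewrite (sub_trans G); apply: Linf_le_trans (Linf_leD FG sG); lra.
Qed.

Lemma APplus_cst (c : C) : APplus (Linf_cst c).
Proof.
rewrite -tpL_cst; apply: APplus_tpL => t; rewrite inE => /eqP -> /=.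
exact: lexx.
Qed.

Lemma APplus1 : APplus (1 : Linf R).
Proof. by rewrite -Linf_cst1; exact: APplus_cst. Qed.

Lemma tpoly_on_cat (D : set R) s s' : tpoly_on D s -> tpoly_on D s' ->
  tpoly_on D (s ++ s').
Proof. by move=> h h' t; rewrite mem_cat => /orP[/h|/h']. Qed.

Lemma tpoly_on_scale (D : set R) c s : tpoly_on D s -> tpoly_on D (tscale c s).
Proof. by move=> h _ /mapP[t /h ? ->]. Qed.

Lemma nonneg_freqD (l l' : R) : nonneg_freq l -> nonneg_freq l' ->
  nonneg_freq (l + l').
Proof. exact: addr_ge0. Qed.

Lemma APplusB F G : APplus F -> APplus G -> APplus (F - G).
Proof.
move=> /APplusP hF /APplusP hG; apply/APplusP => e e0.
have e20 : 0 < e / 2 by rewrite divr_gt0.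
have [s s0 sF] := hF _ e20; have [s' s'0 sG] := hG _ e20.
exists (s ++ tscale (-1) s').
  by apply: tpoly_on_cat => //; exact: tpoly_on_scale.
rewrite tpL_cat tpLN sub_sub.
by apply: Linf_le_trans (Linf_leB sF sG); lra.
Qed.

Lemma APplusM F G : APplus F -> APplus G -> APplus (F * G).
Proof.
move=> /APplusP hF /APplusP hG; apply/APplusP => e e0.
have [A FA] := Linf_le_exists F; have [B GB] := Linf_le_exists G.
have A0 := Linf_le_ge0 FA; have B0 := Linf_le_ge0 GB.
have AB : 0 < A + B + 1 by rewrite ltr_wpDl// addr_ge0.
pose d := Num.min 1 (e / (A + B + 1)).
have d0 : 0 < d by rewrite lt_min ltr01 divr_gt0.
have d1 : d <= 1 by rewrite ge_min lexx.
have dAB : d * (A + B + 1) <= e by rewrite -ler_pdivlMr// ge_min lexx orbT.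
have [s s0 sF] := hF _ d0; have [s' s'0 sG] := hG _ d0.
exists (tmul s s').
  by apply: tpoly_on_mul => //; exact: nonneg_freqD.
rewrite tpL_mul sub_mul.
apply: Linf_le_trans (Linf_leD (Linf_leM sF GB) (Linf_leM (Linf_leB FA sF) sG)).
apply: le_trans dAB; rewrite -subr_ge0.
rewrite (_ : _ - _ = d * (1 - d)); last by ring.
by rewrite mulr_ge0 ?subr_ge0// ltW.
Qed.

Lemma APplus_subring : unital_subring (@APplus R).
Proof. by split; [exact: APplus1|exact: APplusB|exact: APplusM]. Qed.

Lemma APplus_sum (I : Type) (r : seq I) (P : pred I) (H : I -> Linf R) :
  (forall i, P i -> APplus (H i)) -> APplus (\sum_(i <- r | P i) H i).
Proof.
exact: (sring_sum APplus_subring).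
Qed.

Lemma APplusX F k : APplus F -> APplus (F ^+ k).
Proof.
move=> hF; elim: k => [|k IH]; first exact: APplus1.
by rewrite exprS; exact: APplusM.
Qed.

(** The inverse exists in [Linf]; it lies in AP+ as a limit of the partial sums of the Neumann
    series. *)
Lemma APplus_inv_near1 F : APplus F -> Linf_le (F - 1) (1 / 2) ->
  exists G, [/\ APplus G, F * G = 1 & Linf_le G 2].
Proof.
move=> hF F1; have [G FG G2] := Linf_inv_near1 F1.
exists G; split; [|exact: FG|exact: G2]; apply: APplus_closed => e e0.
have [N hN] : exists N : nat, 2 / e < N%:R.
  by exists (Num.truncn (2 / e)).+1; exact: truncnS_gt.
exists (\sum_(i < N) (1 - F) ^+ i).
  apply: APplus_sum => i _; apply: APplusX.
  by apply: APplusB; [exact: APplus1|exact: hF].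
rewrite (sub_geometric _ FG).
apply: Linf_le_trans (Linf_leM G2 (Linf_leX N (Linf_le_distC F1))).
have N0 : 0 < N%:R :> R by apply: le_lt_trans hN; rewrite divr_ge0// ltW.
(* The remainder is at most [2 / 2 ^ N], hence at most [2 / N], which is below [e]. *)
have h2 : N%:R <= 2 ^+ N :> R.
  have := @bernoulli_ineq R 1 N ler01; rewrite mulr1 => h.
  by apply: le_trans h; rewrite lerDr.
rewrite mul1r exprVn ler_pdivrMr ?exprn_gt0//.
apply: (@le_trans _ _ (e * N%:R)); last by rewrite ler_wpM2l// ltW.
by rewrite mulrC -ler_pdivrMr// ltW.
Qed.

End APplusTheory.

(** * Matrices over AP+ *)

Section NearIdentity.
(** [bounded x b] stands for a norm bound of [x] by [b]; the case of interest is [Linf_le]. *)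
Variables (R : realType) (A : comNzRingType) (S : set A)
  (bounded : A -> R -> Prop).
Hypothesis hS : unital_subring S.
Hypothesis bounded_ge0 : forall x b, bounded x b -> 0 <= b.
Hypothesis bounded_le : forall x b c, b <= c -> bounded x b -> bounded x c.
Hypothesis bounded0 : bounded 0 0.
Hypothesis boundedB : forall x y b c, bounded x b -> bounded y c ->
  bounded (x - y) (b + c).
Hypothesis boundedM : forall x y b c, bounded x b -> bounded y c ->
  bounded (x * y) (b * c).
Hypothesis S_inv : forall x, S x -> bounded (x - 1) (1 / 2) ->
  exists y, [/\ S y, x * y = 1 & bounded y 2].

Definition mx_bounded m n (X : 'M[A]_(m, n)) b := forall i j, bounded (X i j) b.

Lemma boundedD x y b c : bounded x b -> bounded y c -> bounded (x + y) (b + c).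
Proof.
move=> xb yc; rewrite -(opprK y) -[c]add0r; apply: boundedB => //.
by rewrite -sub0r; exact: boundedB.
Qed.

Lemma mx_bounded_le m n (X : 'M[A]_(m, n)) b c :
  b <= c -> mx_bounded X b -> mx_bounded X c.
Proof. by move=> bc Xb i j; exact: bounded_le (Xb i j). Qed.

Lemma mx_boundedD m n (X Y : 'M[A]_(m, n)) b c :
  mx_bounded X b -> mx_bounded Y c -> mx_bounded (X + Y) (b + c).
Proof. by move=> Xb Yc i j; rewrite mxE; exact: boundedD. Qed.

Lemma mx_bounded_mul m n p (X : 'M[A]_(m, n)) (Y : 'M[A]_(n, p)) b c :
  mx_bounded X b -> mx_bounded Y c -> mx_bounded (X *m Y) (n%:R * (b * c)).
Proof.
move=> Xb Yc i j; rewrite mxE.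
have -> : n%:R * (b * c) = \sum_(k < n) (b * c).
  by rewrite sumr_const card_ord mulr_natl.
by apply: (big_ind2 bounded) => // [*|k _]; [exact: boundedD|exact: boundedM].
Qed.

(** A pivot close to 1 is invertible with inverse bounded by 2, and the Schur complement is again
    close to the identity. *)
Lemma near1_GEn n : exists2 e, 0 < e & forall X : 'M[A]_n, entries_in S X ->
  mx_bounded (X - 1%:M) e -> GEn S X.
Proof.
elim: n => [|n [e e0 IH]].
  exists 1 => // X _ _; have -> : X = 1%:M by apply/matrixP => -[].
  by apply: (GEn_En hS); exact: (En1 hS).
(* The Schur complement is within [d + 2 d ^ 2] of the identity; this is at most [2 d] as
   [d <= 1 / 2], and [2 d <= e]. *)
exists (Num.min (1 / 2) (e / 2)); first by rewrite lt_min !divr_gt0.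
move=> X SX; set d := Num.min _ _ => Xd.
have d2 : d <= 1 / 2 by rewrite ge_min lexx.
have de : d <= e / 2 by rewrite ge_min lexx orbT.
pose Y : 'M[A]_(1 + n) := X; pose a := Y 0 0.
have Xb i j : bounded (Y i j - (i == j)%:R) d by have := Xd i j; rewrite !mxE.
have [a' [Sa' aa' a'2]] : exists y, [/\ S y, a * y = 1 & bounded y 2].
  by apply: S_inv;
    [exact: SX|apply: bounded_le d2 _; have := Xb 0 0; rewrite eqxx].
have -> : X =
  block_mx a%:M (ursubmx Y) (dlsubmx Y) (drsubmx Y) :> 'M[A]_(1 + n).
  rewrite -[LHS](submxK Y); congr block_mx; apply/matrixP => i j.
  by rewrite !ord1 !mxE mulr1n; congr (Y _ _); apply: val_inj.
apply: (GEn_block hS (SX _ _) Sa' aa').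
- by move=> i j; rewrite !mxE; exact: SX.
- by move=> i j; rewrite !mxE; exact: SX.
apply: IH => i j; rewrite !mxE.
  apply: (sringB hS); first exact: SX.
  apply: (sringM hS) => //; rewrite big_ord1 !mxE.
  by apply: (sringM hS); exact: SX.
rewrite big_ord1 !mxE.
have h1 := Xb (rshift 1 i) (rshift 1 j).
rewrite (inj_eq (@rshift_inj _ _)) in h1.
have h2 := Xb (rshift 1 i) (lshift n 0); rewrite eq_rlshift subr0 in h2.
have h3 := Xb (lshift n 0) (rshift 1 j); rewrite eq_lrshift subr0 in h3.
rewrite addrAC.
apply: bounded_le (boundedB h1 (boundedM a'2 (boundedM h2 h3))).
by have := bounded_ge0 h2; nra.
Qed.

(** [Y] is an approximate left inverse of both [X] and [X'], so [Y X] and [Y X'] are near the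
    identity. The second product and [X'] give [Y]; then [Y] and the first product give [X]. *)
Lemma GEn_perturb n e b d (X X' Y : 'M[A]_n) : 0 <= e ->
  (forall Z : 'M[A]_n, entries_in S Z -> mx_bounded (Z - 1%:M) e -> GEn S Z) ->
  entries_in S X -> entries_in S X' -> entries_in S Y ->
  mx_bounded (Y *m X - 1%:M) (e / 2) -> mx_bounded Y b ->
  mx_bounded (X' - X) d -> n%:R * (b * d) <= e / 2 -> GEn S X' -> GEn S X.
Proof.
move=> e0 near SX SX' SY YX Yb XX' bd GX'.
have GYX : GEn S (Y *m X).
  apply: near; first exact: (entries_in_mul hS).
  by apply: mx_bounded_le YX; lra.
have GYX' : GEn S (Y *m X').
  apply: near; first exact: (entries_in_mul hS).
  have -> : Y *m X' - 1%:M = (Y *m X - 1%:M) + Y *m (X' - X).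
    by rewrite mulmxBr [RHS]addrC addrA subrK.
  apply: mx_bounded_le (mx_boundedD YX (mx_bounded_mul Yb XX')).
  by rewrite [leRHS]splitr lerD2l.
exact: (GEn_cancell hS (GEn_cancelr hS GX' GYX') GYX).
Qed.

End NearIdentity.

(** * Multiplicative multipliers bounded by 1 *)

Section Multipliers.
Variable R : realType.
Implicit Types (m : R -> R) (F : seq R) (s : tpoly R).

Definition contraction m := multiplicative_on (@nonneg_freq R) m /\
  forall l, 0 <= l -> `|m l| <= 1.

(** [exp_mult y] moves [x] to [x + i y]; [zero_mult] is its limit as [y] tends
    to infinity. *)
Definition exp_mult (y l : R) : R := expR (- (y * l)).
Definition zero_mult (l : R) : R := (l == 0)%:R.

Lemma exp_mult_contraction y : 0 <= y -> contraction (exp_mult y).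
Proof.
move=> y0; split; [split|] => //.
- exact: lexx.
- by move=> l l'; exact: nonneg_freqD.
- by rewrite /exp_mult mulr0 oppr0 expR0.
- by move=> l l' _ _; rewrite /exp_mult mulrDr opprD expRD.
- move=> l l0; rewrite ger0_norm ?expR_ge0// -expR0 ler_expR oppr_le0.
  exact: mulr_ge0.
Qed.

Lemma zero_mult_contraction : contraction zero_mult.
Proof.
split; [split|] => //.
- exact: lexx.
- by move=> l l'; exact: nonneg_freqD.
- by rewrite /zero_mult eqxx.
- by move=> l l' l0 l'0; rewrite /zero_mult paddr_eq0// -natrM mulnb.
- by move=> l _; rewrite /zero_mult; case: eqP => _; rewrite ?normr0 ?normr1.
Qed.

Lemma exp_mult0 l : exp_mult 0 l = 1.
Proof. by rewrite /exp_mult mul0r oppr0 expR0. Qed.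

Definition close_on F m m' d := forall l, l \in F -> 0 <= l -> `|m l - m' l| <=
  d.

(** The step is uniform in [y]: the difference is [e^(- y l) (1 - e^(- h l))], at most [h l] because
    [e^(- y l) <= 1]. *)
Lemma exp_mult_step F d : 0 < d -> exists2 h, 0 < h &
  forall y, 0 <= y -> close_on F (exp_mult y) (exp_mult (y + h)) d.
Proof.
move=> d0; pose L := \sum_(l <- F) `|l|.
have L1 : 0 < L + 1 by rewrite ltr_wpDl// sumr_ge0.
exists (d / (L + 1)); first exact: divr_gt0.
move=> y y0 l lF l0; set h := d / _.
have -> : exp_mult y l - exp_mult (y + h) l =
    exp_mult y l * (1 - expR (- (h * l))).
  by rewrite /exp_mult mulrDl opprD expRD mulrBr mulr1.
have [_ /(_ l l0) m1] := exp_mult_contraction y0.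
rewrite normrM -[leRHS]mul1r; apply: ler_pM => //.
have hl : h * l <= d.
  rewrite mulrAC ler_pdivrMr// ler_pM2l//.
  apply: (@le_trans _ _ L); last by rewrite lerDl.
  by rewrite /L (big_rem l)//= ger0_norm// lerDl sumr_ge0.
rewrite ger0_norm; last first.
  rewrite subr_ge0 -expR0 ler_expR oppr_le0 mulr_ge0// divr_ge0// ltW//.
by have := expR_ge1Dx (- (h * l)); lra.
Qed.

Lemma exp_mult_cvg F d : 0 < d -> exists Y, forall y, Y <= y ->
  close_on F (exp_mult y) zero_mult d.
Proof.
move=> d0; elim: F => [|l F [Y IH]]; first by exists 0.
(* For [l > 0], [e^(- y l) <= 1 / (1 + y l) <= d] as soon as [y >= 1 / (d l)]; at [l = 0] both
   multipliers are 1. *)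
exists (Num.max Y (1 / (d * l))) => y; rewrite ge_max => /andP[/IH Yy ly].
move=> l' + l'0; rewrite inE => /predU1P[l'E|l'F]; last exact: Yy.
rewrite {l'}l'E in l'0 *; rewrite /zero_mult.
have [->|ln0] := eqVneq l 0.
  by rewrite /exp_mult mulr0 oppr0 expR0 subrr normr0 ltW.
have lp : 0 < l by rewrite lt_neqAle eq_sym ln0.
rewrite subr0 ger0_norm ?expR_ge0// /exp_mult expRN invf_ple ?posrE ?expR_gt0//.
apply: le_trans (expR_ge1Dx _); move: ly.
rewrite ler_pdivrMr ?mulr_gt0// => ly.
apply: (@le_trans _ _ (y * l)); last by rewrite lerDr.
rewrite -div1r ler_pdivrMr//; apply: le_trans ly _.
by rewrite mulrA mulrAC.
Qed.

Lemma Linf_le_twist_diff F s m m' d : (forall l, l \in freqs s -> l \in F) ->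
  tpoly_on (@nonneg_freq R) s -> close_on F m m' d ->
  Linf_le (tpL (twist m s) - tpL (twist m' s)) ((\sum_(t <- s) normc t.1) * d).
Proof.
move=> sF s0 mm'.
apply/(Linf_leP _ (class_ofD (class_of_tpL _) (class_ofN (class_of_tpL _))));
  apply/aeW => x.
rewrite /tp !big_map -sumrB; apply: (le_trans (le_normc_sum _ _ _)).
rewrite mulr_suml big_seq [leRHS]big_seq; apply: ler_sum => t ts /=.
rewrite -mulrBl -mulrBr -rmorphB !normcM normc_eix mulr1 normcR.
apply: ler_wpM2l; first exact: normc_ge0.
by apply: mm'; [apply: sF; exact: map_f|exact: s0].
Qed.

Lemma Linf_le_twist s m B : contraction m -> tpoly_on (@nonneg_freq R) s ->
  Linf_le (tpL s) B -> Linf_le (tpL (twist m s)) B.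
Proof.
move=> [mm m1] s0 /(Linf_leP _ (class_of_tpL _)) sB; apply/Linf_le_tpL => x.
exact: twist_sup mm m1 s0 sB.
Qed.

End Multipliers.

HB.instance Definition _ (R : realType) :=
  GRing.isZmodMorphism.Build R[i] (Linf R) (@Linf_cst R) (@Linf_cstB R).
HB.instance Definition _ (R : realType) :=
  GRing.isMonoidMorphism.Build R[i] (Linf R) (@Linf_cst R)
    (@Linf_cst1 R, @Linf_cstM R).

(** * Twisting matrices of trigonometric sums *)

Section Deformation.
Variables (R : realType) (n : nat).
Implicit Types (m : R -> R) (p q : 'I_n -> 'I_n -> tpoly R).

Definition twist_mx m p : 'M[Linf R]_n := \matrix_(i, j) tpL (twist m (p i j)).

Definition nonneg_mx p := forall i j, tpoly_on (@nonneg_freq R) (p i j).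

(** Each entry of [Q P - 1] is a single sum [L], independent of [m], to which the multiplier is
    applied. Thus the contraction property transfers to products. *)
Lemma twist_mx_mul p q i j : nonneg_mx p -> nonneg_mx q ->
  exists2 L, tpoly_on (@nonneg_freq R) L & forall m, contraction m ->
  (twist_mx m q *m twist_mx m p - 1%:M) i j = tpL (twist m L).
Proof.
move=> p0 q0.
pose L := flatten [seq tmul (q i k) (p k j) | k <- enum 'I_n].
(* The entry of the identity is a term of frequency 0, which every multiplier fixes. *)
exists (L ++ [:: (- ((i == j)%:R), 0)]).
  apply: tpoly_on_cat => t; last by rewrite inE => /eqP ->; exact: lexx.
  move=> /flatten_mapP[k _]; apply: tpoly_on_mul t; [|exact: q0|exact: p0].
  by move=> l l'; exact: nonneg_freqD.
move=> m [mm _]; have [_ _ m0 _] := mm.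
have cE : Linf_cst (- (i == j)%:R) = - (i == j)%:R :> Linf R.
  by rewrite rmorphN rmorph_nat.
rewrite /twist map_cat tpL_cat /= m0 mulr1 tpL_cst cE !mxE; congr (_ - _).
rewrite map_flatten -map_comp /tpL big_flatten big_map big_enum /=.
apply: eq_bigr => k _; rewrite !mxE -/(tpL _) -/(twist m (tmul _ _)).
by rewrite (twist_mul mm (q0 _ _) (p0 _ _)) tpL_mul.
Qed.

(** [m'] is the trivial multiplier, the start of the path; closeness to the identity there persists
    under any contraction. *)
Lemma twist_mx_near m m' p q e : nonneg_mx p -> nonneg_mx q ->
  contraction m -> contraction m' ->
  (forall l, m' l = 1) ->
  mx_bounded (@Linf_le R) (twist_mx m' q *m twist_mx m' p - 1%:M) e ->
  mx_bounded (@Linf_le R) (twist_mx m q *m twist_mx m p - 1%:M) e.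
Proof.
move=> p0 q0 mc mc' m'1 h i j; have [L L0 LE] := twist_mx_mul i j p0 q0.
rewrite LE//; apply: Linf_le_twist => //; have := h i j; rewrite LE//.
by have -> : m' = (fun=> 1) by [apply/funext]; rewrite twist1.
Qed.

Lemma twist_mx_zero p : twist_mx (@zero_mult R) p =
  map_mx (@Linf_cst R) (\matrix_(i, j) coef (p i j) 0).
Proof.
apply/matrixP => i j; rewrite !mxE.
apply: (class_of_inj (class_of_tpL _) (class_of_cst _)) => x.
rewrite /tp big_map /coef [RHS]big_mkcond; apply: eq_bigr => t _ /=.
rewrite /zero_mult; case: eqP => [->|_]; first by rewrite eix0 !mulr1.
by rewrite mulr0 mul0r.
Qed.

Lemma mx_bounded_exists (X : 'M[Linf R]_n) :
  exists2 b, 0 <= b & mx_bounded (@Linf_le R) X b.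
Proof.
have /choice[f hf] : forall i, exists g : 'I_n -> R, forall j,
  Linf_le (X i j) (g j).
  by move=> i; have /choice[g hg] := fun j => Linf_le_exists (X i j); exists g.
have f0 i j : 0 <= f i j := Linf_le_ge0 (hf i j).
exists (\sum_i \sum_j f i j); first by do 2![apply: sumr_ge0 => ? _].
move=> i j; apply: Linf_le_trans (hf i j).
rewrite (bigD1 i)//= (bigD1 j)//= -addrA lerDl addr_ge0//.
  exact: sumr_ge0.
by do 2![apply: sumr_ge0 => ? _].
Qed.

Lemma mx_approx (X : 'M[Linf R]_n) d : entries_in (@APplus R) X -> 0 < d ->
  exists2 p, nonneg_mx p & forall i j, Linf_le (X i j - tpL (p i j)) d.
Proof.
move=> SX d0.
have h i j : exists s, tpoly_on (@nonneg_freq R) s /\ Linf_le (X i j - tpL s) d.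
  by have [s s0 sX] := (APplusP _).1 (SX i j) _ d0; exists s.
have /choice[p hp] : forall i, exists g : 'I_n -> tpoly R, forall j,
    tpoly_on (@nonneg_freq R) (g j) /\ Linf_le (X i j - tpL (g j)) d.
  by move=> i; have /choice[g hg] := h i; exists g.
by exists p => i j; have [] := hp i j.
Qed.

End Deformation.

(** * The path to a constant matrix *)

Section Connected.
Variables (R : realType) (n : nat).
Local Notation S := (@APplus R).
Local Notation GE := (GEn S).
Local Notation hS := (APplus_subring R).
Local Notation bnd := (mx_bounded (@Linf_le R)).
Local Notation boundD := (mx_boundedD (@Linf_le0 R) (@Linf_leB R)).
Local Notation boundM :=
  (mx_bounded_mul (@Linf_le0 R) (@Linf_leB R) (@Linf_leM R)).

Lemma GEn_of_near1 : exists2 e : R, 0 < e & forall X : 'M[Linf R]_n,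
  entries_in S X -> bnd (X - 1%:M) e -> GE X.
Proof.
exact: (near1_GEn hS (@Linf_le_ge0 R) (@Linf_le_trans R) (@Linf_leB R)
  (@Linf_leM R)
  (@APplus_inv_near1 R)).
Qed.

Lemma twist_mx_entries (m : R -> R) (p : 'I_n -> 'I_n -> tpoly R) :
  nonneg_mx p -> entries_in S (twist_mx m p).
Proof.
move=> p0 i j; rewrite mxE; apply: APplus_tpL => t /mapP[t' t'p ->].
exact: p0 t'p.
Qed.

Lemma twist_mx_bounded (m : R -> R) (p : 'I_n -> 'I_n -> tpoly R) b :
  contraction m -> nonneg_mx p -> (forall i j, Linf_le (tpL (p i j)) b) ->
  bnd (twist_mx m p) b.
Proof. by move=> mc p0 pb i j; rewrite mxE; exact: Linf_le_twist. Qed.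

Lemma twist_mx_diff (p : 'I_n -> 'I_n -> tpoly R) : nonneg_mx p ->
  exists2 K, 0 <= K & exists F, forall m m' d, close_on F m m' d -> 0 <= d ->
    bnd (twist_mx m' p - twist_mx m p) (K * d).
Proof.
move=> p0; pose N i j := \sum_(t <- p i j) normc t.1.
have N0 i j : 0 <= N i j by apply: sumr_ge0 => t _; exact: normc_ge0.
exists (\sum_i \sum_j N i j); first by do 2![apply: sumr_ge0 => ? _].
exists (flatten [seq freqs (p x.1 x.2) | x <- enum {: 'I_n * 'I_n}]).
move=> m m' d mm' d0 i j; rewrite !mxE.
apply: (@Linf_le_trans _ _ (N i j * d)).
  apply: ler_wpM2r => //; rewrite (bigD1 i)//= (bigD1 j)//=
    -addrA lerDl addr_ge0//.
    exact: sumr_ge0.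
  by do 2![apply: sumr_ge0 => ? _].
apply: Linf_le_distC; apply: Linf_le_twist_diff mm'; last exact: p0.
move=> l lp; apply/flatten_mapP; exists (i, j) => //.
by rewrite mem_enum.
Qed.

(** The product is invertible, so the constant matrix of [p] has nonzero determinant, and
    elimination over the complex numbers applies. *)
Lemma GEn_of_const (p q : 'I_n -> 'I_n -> tpoly R) :
  GE (twist_mx (@zero_mult R) q *m twist_mx (@zero_mult R) p) ->
  GE (twist_mx (@zero_mult R) p).
Proof.
move=> /(GEn_inv hS)[Y _ QPY]; rewrite twist_mx_zero.
apply: (GEn_unitmx hS (phi := @Linf_cst R)); first exact: APplus_cst.
rewrite unitmxE unitfE; apply/eqP => d0.
have := congr1 determinant QPY; rewrite !det_mulmx det1 (twist_mx_zero p).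
rewrite det_map_mx d0 rmorph0 mulr0 mul0r => /esym/eqP.
by rewrite oner_eq0.
Qed.

(** Membership in [GE] is shown at the constant end of the path, carried back along the subdivision
    to [P], and from there to [M]. *)
Lemma SLn_GEn M : SLn S n M -> GE M.
Proof.
move=> SLM; have [SM_ _] := SLM.
pose N := \adj M; have NM : N *m M = 1%:M by rewrite mul_adj_mx SLM.2.
have SN_ : entries_in S N by move=> i j; rewrite mxE;
  exact: (sring_cofactor hS).
have [e e0 near] := GEn_of_near1.
have [b1 b10 Mb1] := mx_bounded_exists M; have [b2 b20 Nb2] :=
  mx_bounded_exists N.
pose b := b1 + b2.
have b0 : 0 <= b by exact: addr_ge0.
have Mb : bnd M b by apply: (mx_bounded_le (@Linf_le_trans R)) Mb1;
  rewrite lerDl.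
have Nb : bnd N b by apply: (mx_bounded_le (@Linf_le_trans R)) Nb2;
  rewrite lerDr.
(* As [d <= 1], the error [(Q - N) P + N (P - M)] of [Q P] is at most [d n (2 b + 1)]; the final 1
   makes [K0] positive. *)
pose K0 : R := n%:R * (2 * b + 1) + 1.
have K00 : 0 < K0 by rewrite ltr_wpDl// mulr_ge0// addr_ge0// mulr_ge0.
pose d := Num.min 1 (e / 2 / K0).
have d0 : 0 < d by rewrite lt_min ltr01 !divr_gt0.
have d1 : d <= 1 by rewrite ge_min lexx.
have dK0 : d * K0 <= e / 2 by rewrite -ler_pdivlMr// ge_min lexx orbT.
have [p p0 Mp] := mx_approx SM_ d0; have [q q0 Nq] := mx_approx SN_ d0.
pose m0 := @exp_mult R 0.
have m0c : contraction m0 by exact: exp_mult_contraction.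
have twist_m0 s : twist m0 s = s.
  by rewrite (_ : m0 = fun=> 1) ?twist1//; apply/funext => l; exact: exp_mult0.
pose P := twist_mx m0 p; pose Q := twist_mx m0 q.
have PM : bnd (P - M) d.
  by move=> i j; rewrite !mxE twist_m0; exact: Linf_le_distC (Mp i j).
have QN : bnd (Q - N) d.
  by move=> i j; rewrite !mxE twist_m0; have := Linf_le_distC (Nq i j);
    rewrite mxE.
have Pb : bnd P (b + d).
  by rewrite -[P](subrK M) addrC; exact: boundD Mb PM.
have Qb : bnd Q (b + d).
  by rewrite -[Q](subrK N) addrC; exact: boundD Nb QN.
have nb_ge0 : 0 <= n%:R * b by rewrite mulr_ge0.
have QP : bnd (Q *m P - 1%:M) (e / 2).
  have -> : Q *m P - 1%:M = (Q - N) *m P + N *m (P - M).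
    by rewrite mulmxBl mulmxBr NM addrA subrK.
  apply: (mx_bounded_le (@Linf_le_trans R))
    (boundD (boundM QN Pb) (boundM Nb PM)).
  apply: le_trans dK0; rewrite -subr_ge0.
  have -> : d * K0 - (n%:R * (d * (b + d)) + n%:R * (b * d)) =
      n%:R * (d * (1 - d)) + d by rewrite /K0; ring.
  by rewrite addr_ge0 ?mulr_ge0 ?subr_ge0// ltW.
have QM : bnd (Q *m M - 1%:M) e.
  have -> : Q *m M - 1%:M = (Q - N) *m M by rewrite mulmxBl NM.
  apply: (mx_bounded_le (@Linf_le_trans R)) (boundM QN Mb).
  apply: (@le_trans _ _ (e / 2)); last by lra.
  apply: le_trans dK0; rewrite -subr_ge0.
  have -> : d * K0 - n%:R * (d * b) = d * (n%:R * b + n%:R + 1) by rewrite /K0;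
    ring.
  by rewrite mulr_ge0 ?addr_ge0// ltW.
have QPm m : contraction m -> bnd (twist_mx m q *m twist_mx m p - 1%:M) (e / 2).
  move=> mc; apply: (twist_mx_near p0 q0 mc m0c) QP.
  exact: exp_mult0.
have qb i j : Linf_le (tpL (q i j)) (b + d).
  by have := Qb i j; rewrite mxE twist_m0.
have [K Kge0 [F diffF]] := twist_mx_diff p0.
(* [Q] is bounded by [b + d] and the twisted [P] moves by at most [K del] in a step, so
   [del K1 = e / 2] is what [GEn_perturb] requires. *)
pose K1 : R := n%:R * ((b + d) * K) + 1.
have bd0 : 0 <= b + d by rewrite addr_ge0// ltW.
have K10 : 0 < K1 by rewrite ltr_wpDl// !mulr_ge0.
pose del := e / 2 / K1.
have del0 : 0 < del by rewrite !divr_gt0.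
have step m m' : contraction m -> close_on F m m' del -> contraction m' ->
    GE (twist_mx m' p) -> GE (twist_mx m p).
  move=> mc mm' mc'.
  apply: (GEn_perturb hS (@Linf_le_trans R) (@Linf_le0 R) (@Linf_leB R)
    (@Linf_leM R) (ltW e0) near
    (twist_mx_entries _ p0) (twist_mx_entries _ p0) (twist_mx_entries _ q0)
    (QPm m mc) (twist_mx_bounded mc q0 qb) (diffF m m' del mm' (ltW del0))).
  apply: (@le_trans _ _ (del * K1)); last by rewrite divfK// gt_eqF.
  have -> : n%:R * ((b + d) * (K * del)) = del * (n%:R * ((b + d) * K)) by ring.
  by rewrite ler_pM2l// lerDl.
have [Y hY] := exp_mult_cvg F del0; have [h h0 hstep] := exp_mult_step F del0.
(* After [k] steps of length [h] the path has passed [Y], from where one jump leads to the constant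
   matrix. *)
have [k hk] : exists k : nat, Y / h < k%:R.
  by exists (Num.truncn (Y / h)).+1; exact: truncnS_gt.
have exp_c (i : nat) : contraction (exp_mult (i%:R * h)).
  by apply: exp_mult_contraction; rewrite mulr_ge0// ltW.
have zc := zero_mult_contraction R.
have GEz : GE (twist_mx (@zero_mult R) p).
  apply: (@GEn_of_const p q); apply: near.
    by apply: (entries_in_mul hS); apply: twist_mx_entries.
  by apply: (mx_bounded_le (@Linf_le_trans R)) (QPm _ zc); lra.
have GEk : GE (twist_mx (exp_mult (k%:R * h)) p).
  apply: step zc GEz; first exact: exp_c.
  by apply: hY; move: hk; rewrite ltr_pdivrMr// => /ltW.
have GE0 : GE P.
  have : GE (twist_mx (exp_mult (0%:R * h)) p).
    elim: k GEk {hk} => // i IH GEi; apply: IH.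
    apply: step (exp_c i.+1) GEi; first exact: exp_c.
    by rewrite -natr1 mulrDl mul1r; apply: hstep; rewrite mulr_ge0// ltW.
  by rewrite mul0r.
have Pin : entries_in S P by exact: twist_mx_entries.
have Qin : entries_in S Q by exact: twist_mx_entries.
have GEQP : GE (Q *m P).
  apply: near; first exact: (entries_in_mul hS).
  by apply: (mx_bounded_le (@Linf_le_trans R)) QP; lra.
have GEQM : GE (Q *m M) by apply: near QM; exact: (entries_in_mul hS Qin SM_).
(* [P] and [Q P] give [Q]; then [Q] and [Q M] give [M]. *)
exact: (GEn_cancell hS (GEn_cancelr hS GE0 GEQP) GEQM).
Qed.

End Connected.

Theorem corollary4p2 (R : realType) (n : nat) (hn : (0 < n)%N) :
  SLn (@APplus R) n = En (@APplus R) n.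
Proof.
have hS := APplus_subring R.
apply/seteqP; split=> [M SLM|]; last exact: (En_SLn hS).
by apply: (GEn_det1 hS (SLn_GEn SLM)); have [] := SLM.
Qed.
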